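(* $14.12\le L(12453)\le 14.66$. In particular, $L(12453)$ is not an integer.
   Context: A permutation $p=p_1\cdots p_n$ of $[n]$ contains a pattern $q=q_1\cdots q_k$ (a permutation of $[k]$) if there are indices $i_1<\dots<i_k$ with $p_{i_a}<p_{i_b}$ iff $q_a<q_b$; otherwise $p$ avoids $q$. $S_n(q)$ is the number of permutations of length $n$ avoiding $q$, and $L(q)=\lim_{n\to\infty}\sqrt[n]{S_n(q)}$ (this limit is known to exist for every pattern $q$). *)

(* Defs.v *)
From HB Require Import structures.
From mathcomp Require Import all_boot all_order all_fingroup all_algebra.
From mathcomp Require Import all_classical all_reals all_analysis.

Set Implicit Arguments.
Unset Strict Implicit.
Unset Printing Implicit Defensive.

Import Order.TTheory GRing.Theory Num.Theory.
Import numFieldNormedType.Exports.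

Local Open Scope ring_scope.

(* Permutations of [n] are 0-based here: an element of 'S_n permutes
   'I_n = {0, ..., n-1}, so every entry and position is shifted down by one. *)
Definition contains (n k : nat) (p : 'S_n) (q : 'S_k) : bool :=
  [exists i : {ffun 'I_k -> 'I_n},
    [forall a : 'I_k, forall b : 'I_k, (a < b)%N ==> (i a < i b)%N] &&
    [forall a : 'I_k, forall b : 'I_k,
       (p (i a) < p (i b))%N == (q a < q b)%N]].

Definition avoids (n k : nat) (p : 'S_n) (q : 'S_k) : bool := ~~ contains p q.

Definition nb_avoiders (n k : nat) (q : 'S_k) : nat :=
  #|[set p : 'S_n | avoids p q]|.

(* The n-th root is powR with exponent 1/n; its value at n = 0 (where it is 1)
   does not affect the limit.  limn is total and returns 0 for a divergent
   sequence, so a positive lower bound on growth_rate entails convergence. *)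
Definition growth_rate (R : realType) (k : nat) (q : 'S_k) : R :=
  limn (fun n : nat => (nb_avoiders n q)%:R `^ (n%:R)^-1 : R).

Definition fun12453 (i : 'I_5) : 'I_5 := inord (nth 0 [:: 0; 1; 3; 4; 2] i)%N.

Lemma fun12453_inj : injective fun12453.
Proof.
move=> [[|[|[|[|[|i]]]]] Hi] // [[|[|[|[|[|j]]]]] Hj] // /(congr1 val);
  rewrite /fun12453 /= !inordK // => _; exact: val_inj.
Qed.

Definition pattern12453 : 'S_5 := perm fun12453_inj.

Lemma pattern12453E :
  [seq (val (pattern12453 i)).+1 | i <- enum 'I_5] = [:: 1; 2; 4; 5; 3]%N.
Proof.
have -> : [seq (val (pattern12453 i)).+1 | i <- enum 'I_5]
  = [seq (nth 0 [:: 0; 1; 3; 4; 2] i).+1 | i <- map val (enum 'I_5)]%N.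
  rewrite -map_comp; apply: eq_map => i /=.
  by rewrite permE /fun12453; case: i => [[|[|[|[|[|i]]]]] Hi] //=; rewrite inordK.
by rewrite val_enum_ord.
Qed.

(* Main.v *)
(* Complementing values turns 12453 into 54213 and 1342 into 4213. A permutation
   avoids 54213 iff its entries other than left-to-right maxima avoid 4213. It is
   determined by the positions and values of its maxima and by the pattern of the
   other entries, so if the 4213-avoiders grow like c^n, the 54213-avoiders grow
   at most like (sum over k of C(n,k)^2 c^(n-k)), hence at most like
   (1 + sqrt c)^(2n). Gluing blocks in which maxima and other entries are
   interleaved arbitrarily shows that nothing is lost. The limit exists by
   Fekete's lemma, since 54213-avoiders are closed under direct sums.

   For 4213 the growth rate is 8 (Bona). Prefixing entries one at a time gives a
   generating tree in which the state is a height with a set of marked levels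
   below it, and the first-passage decomposition of the walks in this tree leads
   to a quadratic equation with one catalytic variable. Its solution at the
   critical point z = 1/8 is a potential that decreases along the tree, whence
   the upper bound 8^n; for the lower bound, walks of bounded height already grow
   like 7.65^n, which is checked numerically. Then
   (1 + sqrt 7.65)^2 > 14.12 and (1 + sqrt 8)^2 < 14.66. *)
From HB Require Import structures.
From Stdlib Require Import NArith PArith.
Require Import Defs.
From mathcomp Require Import all_boot all_order all_fingroup all_algebra.
From mathcomp Require Import all_classical all_reals all_analysis.
From mathcomp Require Import zify ring lra.

Set Implicit Arguments.
Unset Strict Implicit.
Unset Printing Implicit Defensive.

Import Order.TTheory GRing.Theory Num.Theory.
Import numFieldNormedType.Exports.

(** * The generating tree of the 4213-avoiders *)

Local Open Scope nat_scope.

(** Raising the entries from [v] on keeps the word a permutation, so that permutations grow from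
    right to left. *)
Definition ins (v : nat) (p : seq nat) : seq nat := v :: map (bump v) p.

Arguments ins : simpl never.

Lemma size_ins v p : size (ins v p) = (size p).+1.
Proof. by rewrite /= size_map. Qed.

Definition contains4213 (p : seq nat) : Prop :=
  exists w x y z, subseq [:: w; x; y; z] p /\ [&& y < x, x < z & z < w].

Definition contains213_below (a : nat) (p : seq nat) : Prop :=
  exists x y z, subseq [:: x; y; z] p /\ [&& y < x, x < z & z < a].

(** An ascent across level [h]: if [h] is prefixed, it plays the 2 of a 213 with this pair. *)
Definition crossed (h a : nat) (p : seq nat) : Prop :=
  exists x y, subseq [:: x; y] p /\ [&& x < h, h <= y & y < a].

Lemma subseq_consP (T : eqType) (x v : T) s q :
  subseq (x :: s) (v :: q) <-> (x = v /\ subseq s q) \/ subseq (x :: s) q.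
Proof.
split=> [/=|[[-> h]|h]]; last by apply: subseq_trans h (subseq_cons _ _).
  by case: eqP => [->|_] h; [left|right].
by rewrite /= eqxx.
Qed.

Lemma subseq_mapP (T U : eqType) (f : T -> U) s q :
  subseq s (map f q) <-> exists2 t, s = map f t & subseq t q.
Proof.
split=> [/subseqP[m szm ->]|[t -> h]]; last exact: map_subseq.
by exists (mask m q); rewrite ?map_mask ?mask_subseq.
Qed.

(** In a new occurrence the first entry plays the 4, and the 213 below it was already there. *)
Lemma contains4213_ins v p :
  contains4213 (ins v p) <-> contains4213 p \/ contains213_below v p.
Proof.
split=> [[w [x [y [z []]]]]|[[w [x [y [z [sq lt]]]]]|[x [y [z [sq lt]]]]]].
- rewrite subseq_consP => -[[->]|] /subseq_mapP[] [|a [|b [|c [|d []]]]] //=.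
    move=> [-> -> ->] sq lt; right; exists a, b, c; split=> //.
    by move: lt; rewrite /bump; lia.
  move=> [-> -> -> ->] sq lt; left; exists a, b, c, d; split=> //.
  by move: lt; rewrite /bump; lia.
- exists (bump v w), (bump v x), (bump v y), (bump v z); split; last first.
    by move: lt; rewrite /bump; lia.
  by apply/subseq_consP; right; apply: (map_subseq (bump v) sq).
- exists v, x, y, z; split=> //; apply/subseq_consP; left; split=> //.
  apply/subseq_mapP; exists [:: x; y; z] => //=.
  by rewrite /bump; congr [:: _; _; _]; lia.
Qed.

Lemma contains213_below_ins v b p : v <= b ->
  contains213_below b.+1 (ins v p) <-> crossed v b p \/ contains213_below b p.
Proof.
move=> vb; split=> [[x [y [z []]]]|[[x [y [sq lt]]]|[x [y [z [sq lt]]]]]].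
- rewrite subseq_consP => -[[->]|] /subseq_mapP[] [|a [|c [|d []]]] //=.
    move=> [-> ->] sq lt; left; exists a, c; split=> //.
    by move: lt; rewrite /bump; lia.
  move=> [-> -> ->] sq lt; right; exists a, c, d; split=> //.
  by move: lt; rewrite /bump; lia.
- exists v, x, y.+1; split; last by lia.
  apply/subseq_consP; left; split=> //.
  apply/subseq_mapP; exists [:: x; y] => //=.
  by rewrite /bump; congr [:: _; _]; lia.
- exists (bump v x), (bump v y), (bump v z); split; last first.
    by move: lt; rewrite /bump; lia.
  by apply/subseq_consP; right; apply: (map_subseq (bump v) sq).
Qed.

Lemma crossed_ins_le v h b p : h <= v <= b ->
  crossed h b.+1 (ins v p) <-> crossed h b p.
Proof.
move=> hvb; split=> [[x [y []]]|[x [y [sq lt]]]].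
- rewrite subseq_consP => -[[->]|] /subseq_mapP[] [|a [|c []]] //=.
    by move=> _ _; lia.
  move=> [-> ->] sq lt; exists a, c; split=> //.
  by move: lt; rewrite /bump; lia.
- exists (bump v x), (bump v y); split; last first.
    by move: lt; rewrite /bump; lia.
  by apply/subseq_consP; right; apply: (map_subseq (bump v) sq).
Qed.

Lemma crossed_ins_gt v h b p : v < h <= b -> h.-1 \in p ->
  crossed h b.+1 (ins v p).
Proof.
move=> vhb hp; exists v, h; split; last by lia.
apply/subseq_consP; left; split=> //; rewrite sub1seq.
by apply/mapP; exists h.-1 => //; rewrite /bump; lia.
Qed.

Lemma uniq_subseq_cat (T : eqType) (x y : T) p :
  uniq p -> x \in p -> y \in p -> x != y ->
  subseq [:: x; y] p \/ subseq [:: y; x] p.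
Proof.
move=> up /path.splitPr h; case: h => p1 p2; rewrite mem_cat inE => + xy.
rewrite [y == x]eq_sym (negPf xy) /= => /orP[yp|yp].
  right; rewrite (_ : [:: y; x] = [:: y] ++ [:: x]) //.
  by apply: cat_subseq; rewrite sub1seq // mem_head.
left; rewrite -[[:: x; y]]cat0s; apply: cat_subseq; first exact: sub0seq.
by rewrite /= eqxx sub1seq.
Qed.

Lemma uniq_subseq3 (T : eqType) (x y z : T) p :
  uniq p -> subseq [:: x; y] p -> subseq [:: y; z] p -> subseq [:: x; y; z] p.
Proof.
elim: p => // v p IH /andP[vp up].
have mem2 a b : subseq [:: a; b] p -> (a \in p) && (b \in p).
  by move=> h; rewrite !(mem_subseq h) // !inE eqxx ?orbT.
rewrite !subseq_consP => -[[-> yp]|xy] [[yv zp]|yz].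
- by move: yp vp; rewrite yv sub1seq => ->.
- by left.
- by have /andP[_] := mem2 _ _ xy; rewrite yv (negPf vp).
- by right; apply: IH.
Qed.

(* A 4213-avoider [p] is summarized by the largest [a] such that its entries
   below [a] avoid 213 and by the set of levels [0 < h < a] that are not crossed
   in [p]: prefixing [v] is allowed iff [v <= a], and what happens next depends
   only on whether [v] is such a level. The levels are stored from [a - 1] down
   to [1], so [a = (size s).+1] and level [h] has index [size s - h]; the levels
   [0] and [a] are never crossed and are left implicit. *)
Definition child (s : seq bool) (v : nat) : seq bool :=
  let a := (size s).+1 in
  if v == a then true :: s
  else if v == 0 then nseq a false
  else if nth false s (size s - v) then nseq (a - v) false ++ drop (size s - v) s
  else true :: drop (size s - v).+1 s.

Fixpoint tree_count (n : nat) (s : seq bool) : nat :=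
  if n is n'.+1 then \sum_(v < (size s).+2) tree_count n' (child s v) else 1.

Record state (p : seq nat) (s : seq bool) : Prop := State {
  state_perm : perm_eq p (iota 0 (size p));
  state_size : size s < size p;
  state_avoid : ~ contains213_below (size s).+1 p;
  state_max : (size s).+1 = size p \/ contains213_below (size s).+2 p;
  state_mark : forall h, 0 < h <= size s ->
    nth false s (size s - h) = ~~ `[< crossed h (size s).+1 p >] }.

Lemma perm_eq_ins v n p : v <= n -> perm_eq p (iota 0 n) ->
  perm_eq (ins v p) (iota 0 n.+1).
Proof.
move=> vn pp; have szp := perm_size pp; rewrite size_iota in szp.
apply: uniq_perm; rewrite ?iota_uniq //.
  rewrite /= map_inj_uniq; last exact: can_inj (bumpK v).
  rewrite (perm_uniq pp) iota_uniq andbT.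
  by apply/mapP => -[x _]; rewrite /bump; lia.
move=> x; rewrite inE mem_iota; apply/idP/idP => [/orP[/eqP->|/mapP[y]]|].
- by lia.
- by rewrite (perm_mem pp) mem_iota /bump => + ->; lia.
- case: (eqVneq x v) => //= xv xn; apply/mapP; exists (unbump v x).
    by rewrite (perm_mem pp) mem_iota /unbump; lia.
  by rewrite /unbump /bump; lia.
Qed.

(** An uncrossed [v] starts no 213 below the old bound, which rises by one; each level [h] above [v]
    becomes crossed by [v] and the entry [h]. A crossed [v] starts a 213 and the bound falls to
    [v + 1]. The marks below [v] survive: as there is no 213 below the bound, a crossed level [h] is
    also crossed by a pair with upper entry [h]. *)
Lemma state_child p s v : state p s -> v <= (size s).+1 ->
  state (ins v p) (child s v).
Proof.
move=> [pp sz av mx mk] va.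
have up : uniq p by rewrite (perm_uniq pp) iota_uniq.
have mem_p x : (x \in p) = (x < size p) by rewrite (perm_mem pp) mem_iota.
have ppv : perm_eq (ins v p) (iota 0 (size (ins v p))).
  by rewrite size_ins; apply: perm_eq_ins => //; lia.
have crossed_self b : ~ crossed b b p.
  by case=> x [y [_]]; lia.
rewrite /child; case: eqP => [vE|/eqP vna].
  have szt : size (true :: s) = (size s).+1 by [].
  subst v; split=> //; rewrite ?szt ?size_ins //.
  - rewrite contains213_below_ins // => -[] //; exact: crossed_self.
  - case: mx => [->|h]; [by left|right].
    by apply/contains213_below_ins => //; right.
  - move=> h hs; case: (eqVneq h (size s).+1) => [->|hne].
      rewrite subnn /=; apply/esym/asboolPn.
      by rewrite crossed_ins_le ?leqnn //; apply: crossed_self.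
    rewrite subSn /=; last by lia.
    rewrite mk; last by lia.
    congr (~~ _); apply: asbool_equiv_eq; apply: iff_sym.
    by rewrite crossed_ins_le //; lia.
set s' := (X in state _ X).
have [marked|/andP[v0 nmarked]] :
  (~ crossed v (size s).+1 p) \/ (0 < v) && ~~ nth false s (size s - v).
- case: (posnP v) => [->|v0]; first by left; case=> x [y [_]]; lia.
  rewrite mk; last by lia.
  case: asboolP => h; by [left|right].
- have szs' : size s' = (size s).+1.
    rewrite /s'; case: (posnP v) => [_|v0]; first by rewrite size_nseq.
    have -> : nth false s (size s - v).
      rewrite mk; [exact/asboolPn|lia].
    by rewrite size_cat size_nseq size_drop; lia.
  split=> //; rewrite ?szs' ?size_ins //.
  + by rewrite contains213_below_ins // => -[].
  + case: mx => [->|h]; [by left|right].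
    by apply/contains213_below_ins => //; [lia|right].
  + move=> h hs; have [hv|vh] := leqP h v.
      have v0 : 0 < v by lia.
      rewrite (_ : `[< _ >] = `[< crossed h (size s).+1 p >]); last first.
        by apply: asbool_equiv_eq; apply: crossed_ins_le; lia.
      rewrite -mk; last by lia.
      rewrite /s' gtn_eqF // mk; last by lia.
      have -> /= : ~~ `[< crossed v (size s).+1 p >] by exact/asboolPn.
      rewrite nth_cat size_nseq nth_drop ifN; last by lia.
      by congr nth; lia.
    have -> : nth false s' ((size s).+1 - h) = false.
      rewrite /s'; case: (posnP v) => [_|v0]; first by rewrite nth_nseq if_same.
      have -> : nth false s (size s - v).
        rewrite mk; [exact/asboolPn|lia].
      rewrite nth_cat size_nseq nth_nseq ifT; last by lia.
      by rewrite if_same.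
    symmetry; apply/negbTE; rewrite negbK; apply/asboolP.
    by apply: crossed_ins_gt; rewrite ?mem_p; lia.
- have {s'}-> : s' = true :: drop (size s - v).+1 s.
    by rewrite /s' gtn_eqF // (negPf nmarked).
  have szd : size (true :: drop (size s - v).+1 s) = v.
    by rewrite /= size_drop; lia.
  have [x0 [y0 [sq0 lt0]]] : crossed v (size s).+1 p.
    by move: nmarked; rewrite mk ?negbK; [move/asboolP|lia].
  split=> //; rewrite ?szd ?size_ins //; try lia.
  + rewrite contains213_below_ins // => -[|h]; first exact: crossed_self.
    apply: av; case: h => x [y [z [sq lt]]]; exists x, y, z; split=> //; lia.
  + right; apply/contains213_below_ins; first by lia.
    (* The upper entry may be taken to be [v]: if [v] came before [x0], then [v], [x0], [y0] would
       be a 213 below the bound. *)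
    left; exists x0, v; split; last by lia.
    have [y0v|y0v] := eqVneq y0 v; first by rewrite -y0v.
    have x0p : x0 \in p by rewrite mem_p; lia.
    have vp : v \in p by rewrite mem_p; lia.
    case: (@uniq_subseq_cat _ x0 v p) => // [|vx]; first by lia.
    case: av; exists v, x0, y0; split; last by lia.
    exact: uniq_subseq3.
  + move=> h /andP[h0 hv]; case: (eqVneq h v) => [->|hne].
      rewrite subnn; apply/esym/asboolPn => /crossed_ins_le.
      by rewrite leqnn => /(_ isT)/crossed_self.
    have -> : nth false (true :: drop (size s - v).+1 s) (v - h)
      = nth false s (size s - h).
      rewrite (_ : v - h = (v - h).-1.+1) /=; last by lia.
      by rewrite nth_drop; congr nth; lia.
    rewrite mk; last by lia.
    congr (~~ _); apply: asbool_equiv_eq.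
    apply: (iff_trans _ (iff_sym (crossed_ins_le _ _))); last by lia.
    split=> [[x [y [sq lt]]]|[x [y [sq lt]]]]; last first.
      by exists x, y; split=> //; lia.
    exists x, h; split; last by lia.
    case: (@uniq_subseq_cat _ x h p) => //; rewrite ?mem_p; try lia.
    have [hy|hy] := eqVneq h y; first by rewrite hy.
    move=> hx; case: av; exists h, x, y; split; last by lia.
    exact: uniq_subseq3.
Qed.

Definition avoiders4213 (n : nat) : seq (seq nat) :=
  [seq p <- permutations (iota 0 n) | ~~ `[< contains4213 p >]].

Definition av4213 (n : nat) : nat := size (avoiders4213 n).

Lemma perm_permutations_ins n :
  perm_eq (permutations (iota 0 n.+1))
    [seq ins v p | p <- permutations (iota 0 n), v <- iota 0 n.+1].
Proof.
apply: uniq_perm; first exact: permutations_uniq.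
  apply: allpairs_uniq; rewrite ?permutations_uniq ?iota_uniq //.
  move=> [p v] [p' v'] _ _ /= [-> /inj_map]; move/(_ (can_inj (bumpK _))).
  by move=> ->.
move=> q; rewrite mem_permutations; apply/idP/allpairsP => [pq|[[p v]] /=].
  have szq := perm_size pq; rewrite size_iota in szq.
  case: q szq pq => // v r [szr] pq; exists (map (unbump v) r, v) => /=.
  have vr : v \notin r.
    by have := iota_uniq 0 n.+1; rewrite -(perm_uniq pq) => /andP[].
  have mem_q x : (x \in v :: r) = (x < n.+1) by rewrite (perm_mem pq) mem_iota.
  have rE : map (bump v) (map (unbump v) r) = r.
    rewrite -map_comp -[RHS]map_id; apply/eq_in_map => x xr /=.
    by rewrite unbumpK // inE; apply: contraNneq vr => <-.
  split; last by rewrite /ins rE.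
  - rewrite mem_permutations; apply: uniq_perm; rewrite ?iota_uniq //.
      rewrite -(map_inj_uniq (can_inj (bumpK v))) rE.
      by have := iota_uniq 0 n.+1; rewrite -(perm_uniq pq) => /andP[].
    move=> x; rewrite -(mem_map (can_inj (bumpK v))) rE mem_iota /=.
    have := mem_q (bump v x); have := mem_q v; rewrite inE eqxx inE.
    have -> /= : (bump v x == v) = false by rewrite /bump; lia.
    by move=> vn ->; rewrite /bump; lia.
  - by rewrite -[0 :: _]/(iota 0 n.+1) mem_iota -mem_q mem_head.
rewrite -[0 :: _]/(iota 0 n.+1) mem_permutations mem_iota.
move=> -[pp vn ->]; apply: perm_eq_ins => //; lia.
Qed.

Fixpoint nb_ext (n : nat) (p : seq nat) : nat :=
  if n is n'.+1 then \sum_(v < (size p).+1) nb_ext n' (ins v p)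
  else ~~ `[< contains4213 p >].

Lemma nb_ext_contains n p : contains4213 p -> nb_ext n p = 0.
Proof.
elim: n p => [|n IH] p cp /=; first by case: asboolP.
by apply: big1 => v _; apply: IH; apply/contains4213_ins; left.
Qed.

(** The entries up to [(size s).+1] are the allowed ones; a larger one completes a 4213, which later
    prefixes cannot destroy. *)
Lemma nb_ext_state n p s : ~ contains4213 p -> state p s ->
  nb_ext n p = tree_count n s.
Proof.
elim: n p s => [|n IH] p s av st /=; first by case: asboolP.
have [_ sz nb mx _] := st.
rewrite (big_ord_widen (size p).+1 (fun v => tree_count n (child s v))).
  rewrite [RHS]big_mkcond; apply: eq_bigr => v _; case: ltnP => hv.
    apply: IH; last exact: state_child.
    case/contains4213_ins => // -[x [y [z [sq lt]]]].
    by apply: nb; exists x, y, z; split=> //; lia.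
  apply: nb_ext_contains; apply/contains4213_ins; right.
  case: mx => [|[x [y [z [sq lt]]]]]; first by have := ltn_ord v; lia.
  by exists x, y, z; split=> //; lia.
by lia.
Qed.

Lemma sum_nb_ext n m :
  \sum_(p <- permutations (iota 0 m)) nb_ext n p = av4213 (m + n).
Proof.
elim: n m => [|n IH] m.
  rewrite addn0 /av4213 size_filter -sum1_count [RHS]big_mkcond.
  by apply: eq_bigr => p _ /=; case: (~~ _).
rewrite -addSnnS -IH (perm_big _ (perm_permutations_ins m)) big_allpairs_dep /=.
rewrite big_seq [RHS]big_seq; apply: eq_bigr => p.
rewrite mem_permutations => /perm_size; rewrite size_iota => szp.
by rewrite -(big_mkord xpredT (fun v => nb_ext n (ins v p))) szp /index_iota subn0.
Qed.

Lemma av4213S n : av4213 n.+1 = tree_count n [::].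
Proof.
rewrite -add1n -sum_nb_ext (perm_big [:: [:: 0]]) ?big_seq1.
  apply: nb_ext_state.
    by case=> w [x [y [z [/size_subseq]]]].
  split=> //=; last by case.
    by case=> x [y [z [/size_subseq]]].
  by left.
by [].
Qed.

(** * Formal power series *)

Local Open Scope ring_scope.

Record fps (R : Type) := Fps { coef_fps : nat -> R }.
Coercion coef_fps : fps >-> Funclass.

HB.instance Definition _ (R : Type) := gen_eqMixin (fps R).
HB.instance Definition _ (R : Type) := gen_choiceMixin (fps R).

Lemma fpsP (R : Type) (f g : fps R) : (forall n, f n = g n) -> f = g.
Proof. by case: f g => [f] [g] /= /funext ->. Qed.

Section FpsRing.
Variable R : comNzRingType.
Implicit Types f g : fps R.

Definition fps0 : fps R := Fps (fun _ => 0).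
Definition fps1 : fps R := Fps (fun n => (n == 0)%:R).
Definition fps_opp f : fps R := Fps (fun n => - f n).
Definition fps_add f g : fps R := Fps (fun n => f n + g n).
Definition fps_mul f g : fps R :=
  Fps (fun n => \sum_(i < n.+1) f i * g (n - i)%N).

Fact fps_addA : associative fps_add.
Proof. by move=> f g h; apply: fpsP => n /=; rewrite addrA. Qed.
Fact fps_addC : commutative fps_add.
Proof. by move=> f g; apply: fpsP => n /=; rewrite addrC. Qed.
Fact fps_add0 : left_id fps0 fps_add.
Proof. by move=> f; apply: fpsP => n /=; rewrite add0r. Qed.
Fact fps_addN : left_inverse fps0 fps_opp fps_add.
Proof. by move=> f; apply: fpsP => n /=; rewrite addNr. Qed.

HB.instance Definition _ :=
  GRing.isZmodule.Build (fps R) fps_addA fps_addC fps_add0 fps_addN.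

(** Through truncations, commutativity and associativity are inherited from polynomials. *)
Definition fps_trunc (n : nat) f : {poly R} := \poly_(i < n.+1) f i.

Fact coef_fps_mul f g m n : (m <= n)%N ->
  fps_mul f g m = (fps_trunc n f * fps_trunc n g)`_m.
Proof.
move=> mn; rewrite coefM; apply: eq_bigr => i _.
by rewrite !coef_poly !ifT //; have := ltn_ord i; lia.
Qed.

Fact fps_mulC : commutative fps_mul.
Proof. by move=> f g; apply: fpsP => n; rewrite !(@coef_fps_mul _ _ n n) // mulrC. Qed.

Fact fps_mulA : associative fps_mul.
Proof.
move=> f g h; apply: fpsP => n.
transitivity ((fps_trunc n f * fps_trunc n g * fps_trunc n h)`_n).
  rewrite -mulrA coefM; apply: eq_bigr => i _.
  rewrite -coef_fps_mul ?leq_subr // coef_poly ifT //.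
rewrite coefM; apply: eq_bigr => i _.
rewrite -coef_fps_mul 1?coef_poly; last by have := ltn_ord i; lia.
by rewrite ifT //; lia.
Qed.

Fact fps_mul1 : left_id fps1 fps_mul.
Proof.
move=> f; apply: fpsP => n /=.
rewrite big_ord_recl /= mul1r subn0 big1 ?addr0 // => i _.
by rewrite mul0r.
Qed.

Fact fps_mulD : left_distributive fps_mul fps_add.
Proof.
move=> f g h; apply: fpsP => n /=.
by rewrite -big_split; apply: eq_bigr => i _ /=; rewrite mulrDl.
Qed.

Fact fps_1_neq0 : fps1 != 0.
Proof.
apply/eqP => /(congr1 (fun f : fps R => f 0%N)) /= /eqP.
by rewrite oner_eq0.
Qed.

HB.instance Definition _ := GRing.Zmodule_isComNzRing.Build (fps R)
  fps_mulA fps_mulC fps_mul1 fps_mulD fps_1_neq0.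

Lemma coef_fpsD f g n : (f + g) n = f n + g n. Proof. by []. Qed.
Lemma coef_fpsN f n : (- f) n = - f n. Proof. by []. Qed.
Lemma coef_fpsB f g n : (f - g) n = f n - g n. Proof. by []. Qed.
Lemma coef_fps0 n : (0 : fps R) n = 0. Proof. by []. Qed.
Lemma coef_fps1 n : (1 : fps R) n = (n == 0%N)%:R. Proof. by []. Qed.
Lemma coef_fpsM f g n : (f * g) n = \sum_(i < n.+1) f i * g (n - i)%N.
Proof. by []. Qed.

Lemma coef_fpsMn f k n : (f *+ k) n = f n *+ k.
Proof. by elim: k => [|k IH]; rewrite ?mulr0n // !mulrS coef_fpsD IH. Qed.

Definition fpsX : fps R := Fps (fun n => (n == 1%N)%:R).

Lemma coef_fpsXM f n : (fpsX * f) n = if n is n'.+1 then f n' else 0.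
Proof.
rewrite coef_fpsM; case: n => [|n]; first by rewrite big_ord1 /= mul0r.
rewrite big_ord_recl /= mul0r add0r big_ord_recl /= mul1r subSS subn0.
by rewrite big1 ?addr0 // => i _; rewrite mul0r.
Qed.

Lemma fpsX_inj f g : fpsX * f = fpsX * g -> f = g.
Proof.
move=> e; apply: fpsP => n.
by have := congr1 (fun h : fps R => h n.+1) e; rewrite !coef_fpsXM.
Qed.

Definition fps_shift f : fps R := Fps (fun n => f n.+1).

Definition fpsC (c : R) : fps R := Fps (fun n => if n is 0%N then c else 0).

Lemma fps_shiftE f : f = fpsC (f 0%N) + fpsX * fps_shift f.
Proof.
by apply: fpsP => -[|n]; rewrite coef_fpsD coef_fpsXM /= ?addr0 ?add0r.
Qed.

Lemma coef_fpsCM c f n : (fpsC c * f) n = c * f n.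
Proof.
rewrite coef_fpsM big_ord_recl /= subn0 big1 ?addr0 // => i _.
by rewrite mul0r.
Qed.

(** Division by [1 - fpsX]. *)
Definition fps_psum f : fps R := Fps (fun n => \sum_(i < n.+1) f i).

Lemma fps_psumE f : (1 - fpsX) * fps_psum f = f.
Proof.
apply: fpsP => n; rewrite mulrBl mul1r coef_fpsB coef_fpsXM.
by case: n => [|n] /=; rewrite ?big_ord1 ?subr0 // big_ord_recr /= addrAC subrr add0r.
Qed.

Lemma fps_1subX_inj f g : (1 - fpsX) * f = (1 - fpsX) * g -> f = g.
Proof.
move=> e; apply: fpsP => n.
have {}e m := congr1 (fun h : fps R => h m) e.
elim: n => [|n IH].
  by have := e 0%N; rewrite !mulrBl !mul1r !coef_fpsB !coef_fpsXM !subr0.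
have := e n.+1; rewrite !mulrBl !mul1r !coef_fpsB !coef_fpsXM IH.
by move=> /addIr.
Qed.

Definition fps_euler f : fps R := Fps (fun n => f n *+ n).

Lemma fps_eulerM f g : fps_euler (f * g) = fps_euler f * g + f * fps_euler g.
Proof.
apply: fpsP => n; rewrite coef_fpsD !coef_fpsM /= -sumrMnl -big_split.
apply: eq_bigr => i _ /=.
by rewrite mulrnAl mulrnAr -mulrnDr subnKC //; have := ltn_ord i; lia.
Qed.
End FpsRing.

(** * The critical series *)

Section Critical.
Variable R : realFieldType.
Local Notation t := (fpsX R).

(* The coefficients of [sqrt ((1 - 3 t)^3 (25 - 27 t))], computed from the
   differential equation of that root. This recurrence also makes their signs
   visible, which the algebraic expression does not. *)
Fixpoint root_rec (n : nat) : R * R :=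
  if n is d.+1 then
    let: (a, b) := root_rec d in
    (b, ((102 * d%:R - 24) * b - 81 * (d%:R - 2) * a) / (25 * d.+2%:R))
  else (5, - (126 / 5)).

Definition root_fps : fps R := Fps (fun n => (root_rec n).1).

Lemma root_fpsE d : 25 * d.+2%:R * root_fps d.+2 =
  (102 * d%:R - 24) * root_fps d.+1 - 81 * (d%:R - 2) * root_fps d.
Proof.
rewrite /=; case: (root_rec d) => a b /=.
by rewrite mulrC divfK // mulf_neq0 ?pnatr_eq0.
Qed.

Local Notation C := (@fpsC R).

Lemma fpsC_nat k : C k%:R = k%:R.
Proof.
apply: fpsP => n; rewrite coef_fpsMn coef_fps1.
by case: n => [|n] //=; rewrite mul0rn.
Qed.

Lemma fps_eulerD (f g : fps R) : fps_euler (f + g) = fps_euler f + fps_euler g.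
Proof. by apply: fpsP => n /=; rewrite mulrnDl. Qed.

Lemma fps_eulerN (f : fps R) : fps_euler (- f) = - fps_euler f.
Proof. by apply: fpsP => n /=; rewrite mulNrn. Qed.

Lemma fps_eulerX : fps_euler t = t.
Proof. by apply: fpsP => -[|[|n]] /=; rewrite ?mulr0n ?mulr1n ?mul0rn. Qed.

Lemma coef_fps_euler (f : fps R) n : fps_euler f n = f n *+ n.
Proof. by []. Qed.

Lemma fps_eulerC c : fps_euler (C c) = 0.
Proof. by apply: fpsP => -[|n] /=; rewrite ?mulr0n ?mul0rn. Qed.

(** This is the logarithmic derivative of [sqrt ((1 - 3 t)^3 (25 - 27 t))], cleared of its
    denominator [(1 - 3 t) (25 - 27 t)]. Coefficientwise it is the recurrence [root_fpsE]. *)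
Lemma root_fps_ode : let h := root_fps in let h' := fps_euler h in
  C 25 * h' - C 102 * (t * h') + C 81 * (t * (t * h'))
  = C 162 * (t * (t * h)) - C 126 * (t * h).
Proof.
apply: fpsP => n.
rewrite !(coef_fpsD, coef_fpsN, coef_fpsCM).
case: n => [|[|d]]; rewrite !coef_fpsXM; first by rewrite /= !mulr0n; ring.
  by rewrite /=; field.
have := root_fpsE d; rewrite !coef_fps_euler.
move: (root_fps d) (root_fps d.+1) (root_fps d.+2) => a b c.
rewrite -(mulr_natr c) -(mulr_natr b) -(mulr_natr a) -(natr1 d.+1) -(natr1 d).
by lra.
Qed.

(** Squares of solutions of [root_fps_ode] satisfy this equation, whose right-hand side is doubled.
    Its leading coefficient [25 n] vanishes only at [n = 0], so the constant term determines the
    solution. *)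
Lemma fps_ode_uniq (f : fps R) : f 0%N = 0 -> let f' := fps_euler f in
  C 25 * f' - C 102 * (t * f') + C 81 * (t * (t * f'))
  = C 324 * (t * (t * f)) - C 252 * (t * f) -> f = 0.
Proof.
move=> f0 f' e; apply: fpsP => n; elim/ltn_ind: n => n IH.
have := congr1 (fun g : fps R => g n) e; rewrite /f' {e f'}.
rewrite !(coef_fpsD, coef_fpsN, coef_fpsCM).
case: n IH => [|n] IH //; rewrite !coef_fpsXM; rewrite !coef_fps_euler (IH n) //.
have -> : (if n is n'.+1 then f n' else 0) = 0.
  by case: n IH => // n IH; apply: IH.
have -> : (if n is n'.+1 then f n' *+ n' else 0) = 0.
  by case: n IH => // n IH; rewrite IH ?mul0rn.
rewrite !(mul0rn, mulr0, addr0, oppr0) => /eqP.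
by rewrite mulf_eq0 pnatr_eq0 mulrn_eq0 /= => /eqP.
Qed.

Lemma root_fps_sqr :
  root_fps * root_fps = (1 - 3 * t) ^+ 3 * (25 - 27 * t).
Proof.
have -> : (1 - 3 * t) ^+ 3 * (25 - 27 * t) = C 25 - C 252 * t
  + C 918 * (t * t) - C 1404 * (t * (t * t)) + C 729 * (t * (t * (t * t))).
  by rewrite !fpsC_nat; ring.
(* Both sides solve the same linear equation and have constant term 25. *)
apply/eqP; rewrite -subr_eq0; apply/eqP; apply: fps_ode_uniq.
  rewrite coef_fpsB !(coef_fpsD, coef_fpsN, coef_fpsCM) coef_fpsM big_ord1.
  by rewrite !coef_fpsXM /=; ring.
have := root_fps_ode; move: root_fps => h /=.
rewrite !(fps_eulerD, fps_eulerN, fps_eulerM, fps_eulerX, fps_eulerC).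
rewrite !fpsC_nat; move: (fps_euler h) => h' /eqP; rewrite -subr_eq0 => /eqP e.
apply/eqP; rewrite -subr_eq0; apply/eqP.
rewrite -[RHS](mulr0 (2 * h)) -[X in _ = _ * X]e.
by ring.
Qed.
End Critical.

(* At [z = 1/8] the kernel equation of the walks, [Y = c + z Q Y] and
   [X = Y (1 + z X / (1 - t))] with [Q = (X - X_0) / t] and [c = 1 + z X_0], is a
   quadratic equation for [X] whose discriminant has a triple root at [t = 1/3]
   when [c = 32/27]; solving it gives [critX] and [critR] below. *)
Lemma critR_identity (A : comNzRingType) (t h r c b Q : A) :
  let p := 5 + 18 * t - 27 * (t * t) in
  h * h - (1 - 3 * t) ^+ 3 * (25 - 27 * t) = 0 ->
  8 * r = p + 8 * t + h -> 27 * c = 32 -> 8 * b = 1 ->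
  27 * (1 - t) * (t * Q) = 4 * (p + h) - 40 * (1 - t) ->
  t * ((1 - t) * (64 * (27 * (r - (c + b * (Q * r)))))) = 0.
Proof.
move=> p hh0 RE cE bE QE.
transitivity (216 * t * (1 - t) * (8 * r) - 64 * t * (1 - t) * (27 * c)
   - (8 * b) * (27 * (1 - t) * (t * Q)) * (8 * r)); first by ring.
rewrite RE cE bE QE -[RHS](mulr0 (-4)) -[X in _ = _ * X]hh0 /p.
by ring.
Qed.

Lemma critX_identity (A : comNzRingType) (t h r X S b : A) :
  let p := 5 + 18 * t - 27 * (t * t) in
  h * h - (1 - 3 * t) ^+ 3 * (25 - 27 * t) = 0 ->
  8 * r = p + 8 * t + h -> 8 * b = 1 -> (1 - t) * S = X ->
  27 * ((1 - t) * X) = 4 * (p + h) ->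
  (1 - t) * ((1 - t) * (64 * (27 * (X - (r + b * (r * S)))))) = 0.
Proof.
move=> p hh0 RE bE SE XE.
transitivity (64 * (1 - t) * (27 * ((1 - t) * X))
   - 216 * (1 - t) ^+ 2 * (8 * r)
   - (8 * b) * (27 * ((1 - t) * ((1 - t) * S))) * (8 * r)); first by ring.
rewrite SE XE RE bE -[RHS](mulr0 (-4)) -[X in _ = _ * X]hh0 /p.
by ring.
Qed.

Section CriticalSeries.
Variable R : realFieldType.
Local Notation t := (fpsX R).
Local Notation C := (@fpsC R).
Local Notation h := (root_fps R).

Let p : fps R := 5 + 18 * t - 27 * (t * t).

Definition crit_step : fps R := C (4 / 27) * (p + h).
Definition critX : fps R := fps_psum crit_step.
Definition critR : fps R := C (1 / 8) * (p + 8 * t + h).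

Lemma fps_natI k (f : fps R) : (0 < k)%N -> k%:R * f = 0 -> f = 0.
Proof.
move=> k0 e; apply: fpsP => n; have : (k%:R * f) n = 0 by rewrite e.
move/eqP; rewrite -fpsC_nat coef_fpsCM.
by rewrite mulf_eq0 pnatr_eq0 gtn_eqF //= => /eqP.
Qed.

Lemma coef_p n : p n = nth 0 [:: 5; 18; -27] n.
Proof.
rewrite /p -!fpsC_nat !(coef_fpsD, coef_fpsN, coef_fpsCM).
case: n => [|[|[|n]]]; rewrite !coef_fpsXM /= ?nth_nil; ring.
Qed.

Lemma coef_psum (f : fps R) n : fps_psum f n = \sum_(i < n.+1) f i.
Proof. by []. Qed.

Lemma fpsCM_nat k c (f : fps R) : k%:R * (C c * f) = C (k%:R * c) * f.
Proof. by rewrite -fpsC_nat; apply: fpsP => n; rewrite !coef_fpsCM mulrA. Qed.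

Lemma natM_fpsC k c m : k%:R * c = m%:R -> k%:R * C c = m%:R.
Proof. by move=> e; rewrite -[C c]mulr1 fpsCM_nat e fpsC_nat mulr1. Qed.

Let stepE : 27 * crit_step = 4 * (p + h).
Proof.
rewrite fpsCM_nat (_ : 27 * (4 / 27) = 4%:R) ?fpsC_nat //; by field.
Qed.

Let RE : 8 * critR = p + 8 * t + h.
Proof.
rewrite fpsCM_nat (_ : 8 * (1 / 8) = 1%:R) ?fpsC_nat ?mul1r //; by field.
Qed.

Lemma critX0 : critX 0%N = 40 / 27.
Proof.
by rewrite coef_psum big_ord1 coef_fpsCM coef_fpsD coef_p /=; field.
Qed.

Let hh0 : h * h - (1 - 3 * t) ^+ 3 * (25 - 27 * t) = 0.
Proof. by rewrite root_fps_sqr subrr. Qed.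

(** The factors 27, 64, [1 - t] and [t] can be cancelled; after multiplication by them the equation
    follows from [root_fps_sqr]. *)
Lemma critR_eq : critR = C (32 / 27) + C (1 / 8) * (fps_shift critX * critR).
Proof.
apply/eqP; rewrite -subr_eq0; apply/eqP.
set Q := fps_shift critX; set c := C (32 / 27); set b := C (1 / 8).
have cE : 27 * c = 32.
  by apply: natM_fpsC; field.
have bE : 8 * b = 1.
  by apply: (@natM_fpsC 8 _ 1); field.
have QE : 27 * (1 - t) * (t * Q) = 4 * (p + h) - 40 * (1 - t).
  have -> : t * Q = critX - C (40 / 27).
    by rewrite [in RHS](fps_shiftE critX) critX0 addrC addKr.
  have cE' : 27 * C (40 / 27) = 40.
    by apply: natM_fpsC; field.
  by rewrite -stepE -(fps_psumE crit_step) -/critX -cE'; ring.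
apply: (@fps_natI 27) => //; apply: (@fps_natI 64) => //.
apply: fps_1subX_inj; apply: fpsX_inj.
rewrite !mulr0; exact: (critR_identity hh0).
Qed.

Lemma critX_eq : critX = critR + C (1 / 8) * (critR * fps_psum critX).
Proof.
apply/eqP; rewrite -subr_eq0; apply/eqP.
set S := fps_psum critX; set b := C (1 / 8).
have bE : 8 * b = 1.
  by apply: (@natM_fpsC 8 _ 1); field.
have SE : (1 - t) * S = critX by exact: fps_psumE.
have XE : (1 - t) * critX = crit_step by exact: fps_psumE.
apply: (@fps_natI 27) => //; apply: (@fps_natI 64) => //; do 2!apply: fps_1subX_inj.
rewrite !mulr0; apply: (critX_identity hh0) => //; by rewrite XE.
Qed.

(** The limit ratios of the recurrence are the roots 27/25 and 3 of [25 x^2 - 102 x + 81]. The ratio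
    bound 9/5 lies between them, where the recurrence reproduces it. *)
Lemma root_fps_growth n :
  0 < root_fps R n.+3 /\ 9 / 5 * root_fps R n.+3 <= root_fps R n.+4.
Proof.
elim: n => [|n [h1 h2]].
  have e0 : h 0%N = 5 by [].
  have e1 : h 1%N = - (126 / 5) by [].
  have := @root_fpsE R 0; have := @root_fpsE R 1; have := @root_fpsE R 2.
  rewrite e0 e1; move: (h 2) (h 3) (h 4) => a b c; lra.
have h3 : 0 < h n.+4 by lra.
split=> //; have := @root_fpsE R n.+3.
rewrite -(natr1 n.+4) -(natr1 n.+3) -(natr1 n.+2) -(natr1 n.+1) -(natr1 n).
have n0 := ler0n R n.
move: (h n.+3) (h n.+4) (h n.+4.+1) n0 h1 h2 h3 => a b c; move: (n%:R) => x.
move=> x0 a0 ab b0 e.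
nra.
Qed.

Lemma root_fps_ge0 n : 0 <= h n.+2.
Proof.
case: n => [|n]; last by case: (root_fps_growth n) => /ltW.
have e0 : h 0%N = 5 by [].
have e1 : h 1%N = - (126 / 5) by [].
have := @root_fpsE R 0; rewrite e0 e1; lra.
Qed.

Lemma root_fps2 : h 2 = 3537 / 125.
Proof.
have e0 : h 0%N = 5 by [].
have e1 : h 1%N = - (126 / 5) by [].
have := @root_fpsE R 0; rewrite e0 e1; lra.
Qed.

Lemma critX_ge0 n : 0 <= critX n.
Proof.
have step_ge0 k : 0 <= crit_step k.+2.
  rewrite coef_fpsCM coef_fpsD coef_p; case: k => [|k].
    by rewrite root_fps2 /=; lra.
  by rewrite nth_default // add0r mulr_ge0 ?root_fps_ge0 //; lra.
have e0 : crit_step 0%N = 40 / 27 by rewrite -critX0 coef_psum big_ord1.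
(* The only negative step; the preceding one outweighs it. *)
have e1 : crit_step 1%N = - (16 / 15).
  by rewrite coef_fpsCM coef_fpsD coef_p /=; field.
elim: n => [|[|n] IH]; [by rewrite critX0; lra| |].
  have -> : critX 1%N = crit_step 0%N + crit_step 1%N.
    by rewrite coef_psum big_ord_recr big_ord1.
  by rewrite e0 e1; lra.
have -> : critX n.+2 = critX n.+1 + crit_step n.+2.
  by rewrite coef_psum big_ord_recr.
by rewrite addr_ge0.
Qed.

Lemma critR_ge0 n : 0 <= critR n.
Proof.
rewrite coef_fpsCM 2!coef_fpsD coef_p -fpsC_nat coef_fpsCM.
apply: mulr_ge0; first by lra.
case: n => [|[|[|n]]].
- by rewrite /=; lra.
- by rewrite /=; lra.
- by rewrite root_fps2 /=; lra.
- by rewrite nth_default //= mulr0 !add0r; apply: (root_fps_ge0 n.+1).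
Qed.
End CriticalSeries.

(** * Potentials on the generating tree *)

Definition inner_child (s : seq bool) (i : nat) : seq bool :=
  if nth false s i then nseq i.+1 false ++ drop i s else true :: drop i.+1 s.

Lemma sum_child (A : nmodType) (f : seq bool -> A) s :
  \sum_(v < (size s).+2) f (child s v) =
  f (true :: s) + f (nseq (size s).+1 false)
  + \sum_(i < size s) f (inner_child s i).
Proof.
rewrite big_ord_recr big_ord_recl /= addrC -addrA.
congr (_ + _); first by rewrite /child eqxx.
congr (f _ + _); rewrite (reindex_inj rev_ord_inj) /=.
apply: eq_bigr => i _; congr f; rewrite /child /inner_child /=.
rewrite /bump /= add1n; have im := ltn_ord i.
have -> : ((size s - i.+1).+1 == (size s).+1) = false by lia.
have -> : (size s - (size s - i.+1).+1)%N = i by lia.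
by have -> : ((size s).+1 - (size s - i.+1).+1)%N = i.+1 by lia.
Qed.

(** From the bottom up, the number of marks kept at a marked level takes the values 1, 2, 3 and so
    on, each once, and level 0 supplies the value 0. This causes the factor [1 / (1 - t)] in the
    kernel equation. *)
Lemma sum_marks (A : nmodType) (G : nat -> A) s :
  G 0%N + \sum_(i < size s | nth false s i) G (count id (drop i s))
  = \sum_(j < (count id s).+1) G j.
Proof.
elim: s => [|b s IH] /=; first by rewrite big_ord0 big_ord1 addr0.
rewrite big_mkcond big_ord_recl -big_mkcond /=.
case: b => /=; last by rewrite add0r IH.
by rewrite add1n [RHS]big_ord_recr /= -IH -addrA; congr (_ + _); rewrite addrC.
Qed.

(* Read the growth of a state as a walk on its height, [X m] counting (by the
   number of levels lost) the walks that start at height [m + 1] and end when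
   they are about to pass below it. [descent s] is the weight of a walk that
   arrives from above just below the top of [s]; its index is the number of
   remaining levels, so that losing levels becomes a Cauchy product. *)
Section Potential.
Variables (R : realFieldType) (z : R) (X Y : nat -> fps R) (d0 e0 : fps R).

Definition lift_level (n : nat) (f : fps R) : fps R :=
  if n is 0%N then e0 else Y n * f.

Fixpoint descent (s : seq bool) : fps R :=
  if s is b :: v then
    let e := lift_level (size v) (descent v) in
    if b then Fps (fun j => if j == (count id v).+1 then descent v (count id v)
                            else e j)
    else e
  else d0.

Definition landing (s : seq bool) : fps R := lift_level (size s) (descent s).

Definition potential (s : seq bool) : R :=
  (X (size s) * descent s) (count id s).

Lemma descent_true s j : descent (true :: s) j =
  if j == (count id s).+1 then descent s (count id s) else landing s j.
Proof. by []. Qed.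

Lemma fps_mul_eq (f g g' : fps R) n :
  (forall i, (i <= n)%N -> g i = g' i) -> (f * g) n = (f * g') n.
Proof.
move=> e; rewrite !coef_fpsM; apply: eq_bigr => i _.
by rewrite e // leq_subr.
Qed.

(** The coefficient of index [j] concerns walks that keep only the lowest [j] marks, so it does not
    see marks above these. *)
Lemma descent_kill s i j : (i <= size s)%N -> (j <= count id (drop i s))%N ->
  descent (nseq i false ++ drop i s) j = descent s j.
Proof.
elim: s i j => [|b s IH] [|i] j //= im jc.
have js : (j <= count id s)%N.
  by apply: leq_trans jc _; rewrite -[in leqRHS](cat_take_drop i s) count_cat leq_addl.
have sv : size (nseq i false ++ drop i s) = size s.
  by rewrite size_cat size_nseq size_drop; lia.
have e : lift_level (size s) (descent (nseq i false ++ drop i s)) j = landing s j.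
  rewrite /landing; case: (size s) => // n; apply: fps_mul_eq => k kj.
  by apply: IH => //; apply: leq_trans jc.
rewrite sv e; case: b => //=.
by rewrite ifN //; lia.
Qed.

Lemma landing_kill s i j : (i <= size s)%N -> (j <= count id (drop i s))%N ->
  landing (nseq i false ++ drop i s) j = landing s j.
Proof.
move=> im jc; rewrite /landing size_cat size_nseq size_drop subnKC //.
case: (size s) => // n; apply: fps_mul_eq => k kj.
by apply: descent_kill => //; apply: leq_trans jc.
Qed.

Lemma potential_kill s i : (i <= size s)%N ->
  potential (nseq i.+1 false ++ drop i s) =
  (X (size s).+1 * landing s) (count id (drop i s)).
Proof.
move=> im; rewrite /potential /= size_cat size_nseq size_drop subnKC //.
rewrite count_cat count_nseq mul0n add0n add0n.
apply: fps_mul_eq => j jc; rewrite -(landing_kill im jc) /landing.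
by rewrite size_cat size_nseq size_drop subnKC.
Qed.

(** The constant coefficient of [X] stands for the walks that keep the new mark; the others lose it
    and land on [s]. *)
Lemma potential_true s : potential (true :: s) =
  X (size s).+1 0%N * descent s (count id s)
  + (fps_shift (X (size s).+1) * landing s) (count id s).
Proof.
rewrite /potential coef_fpsM big_ord_recl subn0 [count id (true :: s)]/= add1n.
rewrite descent_true eqxx; congr (_ + _); rewrite coef_fpsM.
apply: eq_bigr => i _; rewrite subSS descent_true ifN //.
by have := ltn_ord i; lia.
Qed.

(** The share of the children at crossed levels, where the height does not rise. It obeys the same
    recursion along [s] as the coefficient of [descent s] at [count id s]. *)
Definition unmarked_sum (s : seq bool) : R :=
  \sum_(i < size s | ~~ nth false s i) potential (true :: drop i.+1 s).

Lemma fps_psumM (f g : fps R) : fps_psum (f * g) = fps_psum f * g.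
Proof. by apply: fps_1subX_inj; rewrite mulrA !fps_psumE. Qed.

Lemma sum_child_potential s :
  \sum_(v < (size s).+2) potential (child s v) =
  X (size s).+1 0%N * descent s (count id s)
  + (fps_shift (X (size s).+1) * landing s) (count id s)
  + (fps_psum (X (size s).+1) * landing s) (count id s) + unmarked_sum s.
Proof.
rewrite sum_child -potential_true -!addrA; congr (_ + _).
rewrite -fps_psumM coef_psum -(sum_marks (X (size s).+1 * landing s)) -addrA.
congr (_ + _).
  by have := @potential_kill s (size s) (leqnn _); rewrite drop_size cats0.
rewrite (bigID (fun i : 'I__ => nth false s i)) /=; congr (_ + _).
  apply: eq_bigr => i si; rewrite /inner_child si potential_kill //.
  exact: ltnW.
by apply: eq_bigr => i /negPf si; rewrite /inner_child si.
Qed.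

Lemma unmarked_sum_cons b s : unmarked_sum (b :: s) =
  (if b then 0 else potential (true :: s)) + unmarked_sum s.
Proof.
rewrite /unmarked_sum big_mkcond big_ord_recl -big_mkcond /=.
by rewrite drop0; case: b.
Qed.
End Potential.

Lemma tree_countS (A : pzSemiRingType) n s : (tree_count n.+1 s)%:R =
  \sum_(v < (size s).+2) (tree_count n (child s v))%:R :> A.
Proof. by rewrite /= natr_sum. Qed.

Section UpperBound.
Variable R : realFieldType.
Local Notation V :=
  (potential (fun=> critX R) (fun=> critR R) 1 (critR R)).
Local Notation D := (descent (fun=> critR R) 1 (critR R)).
Local Notation E := (landing (fun=> critR R) 1 (critR R)).

Lemma critical_landing s : E s = critR R * D s.
Proof. by case: s => [|b s] //; rewrite /landing /= mulr1. Qed.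

Lemma critical_landing_rec s j : E s j =
  D s j + 8^-1 * (critX R 0%N * D s j + (fps_shift (critX R) * E s) j).
Proof.
rewrite critical_landing {1}critR_eq mulrDl coef_fpsD coef_fpsCM -mulrA.
rewrite coef_fpsCM critX0 -mulrA; move: (D s j) (coef_fps _ j) => a b; by field.
Qed.

(** Induction along [s]: a marked top changes neither side, and by the first kernel equation an
    unmarked top adds [8^-1] times the potential of [true :: s] to both. *)
Lemma critical_descent s :
  D s (count id s) =
    1 + 8^-1 * unmarked_sum (fun=> critX R) (fun=> critR R) 1 (critR R) s.
Proof.
elim: s => [|b s IH]; first by rewrite /unmarked_sum big_ord0 mulr0 addr0.
rewrite unmarked_sum_cons; case: b => /=.
  by rewrite eqxx add0r.
rewrite add0n -/(E s) critical_landing_rec {1}IH potential_true.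
by rewrite [in RHS]mulrDr [RHS]addrA [RHS]addrAC.
Qed.

(** The second kernel equation splits [V] into [E] and the children at uncrossed levels below the
    top, the first one splits [E] into [D] and the child [true :: s], and [critical_descent]
    accounts for [D]. The 1 comes from [descent [::]]. *)
Lemma critical_potential s :
  V s = 1 + 8^-1 * \sum_(v < (size s).+2) V (child s v).
Proof.
rewrite sum_child_potential.
transitivity (E s (count id s)
    + 8^-1 * (fps_psum (critX R) * E s) (count id s)).
  rewrite /potential {1}critX_eq mulrDl coef_fpsD critical_landing.
  by rewrite -mulrA coef_fpsCM div1r -mulrA [in RHS]mulrCA.
move: (critical_landing_rec s (count id s)) (critical_descent s).
move: (E s _) (D s _) (_ * E s) (_ * E s) (unmarked_sum _ _ _ _ _) => a b f g c; lra.
Qed.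

Lemma critical_potential_ge1 s : 1 <= V s.
Proof.
rewrite critical_potential lerDl mulr_ge0 ?invr_ge0 ?ler0n //.
have D_ge0 v j : 0 <= D v j.
  elim: v j => [|b v IH] j; first by rewrite /= ler0n.
  have E_ge0 i : 0 <= E v i.
    rewrite critical_landing coef_fpsM sumr_ge0 // => k _.
    by rewrite mulr_ge0 ?critR_ge0.
  by case: b => /=; [case: ifP|].
apply: sumr_ge0 => v _; rewrite /potential coef_fpsM sumr_ge0 // => k _.
by rewrite mulr_ge0 ?critX_ge0.
Qed.

Lemma tree_count_le n s : (tree_count n s)%:R <= V s * 8 ^+ n.
Proof.
elim: n s => [|n IH] s; first by rewrite mulr1 critical_potential_ge1.
rewrite tree_countS.
apply: (@le_trans _ _ (\sum_(v < (size s).+2) V (child s v) * 8 ^+ n)).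
  exact: ler_sum.
rewrite -mulr_suml exprS mulrA ler_wpM2r ?exprn_ge0 ?ler0n //.
rewrite [V s]critical_potential; lra.
Qed.
End UpperBound.

Lemma av4213_le (R : realFieldType) n : (av4213 n)%:R <= 8 ^+ n :> R.
Proof.
case: n => [|n].
  have : (av4213 0 <= 1)%N by rewrite /av4213 size_filter (leq_trans (count_size _ _)).
  by rewrite expr0 -(ler_nat R).
rewrite av4213S (le_trans (tree_count_le _ _ _)) // exprS.
rewrite ler_wpM2r ?exprn_ge0 ?ler0n //.
rewrite /potential coef_fpsM big_ord1 critX0 /= mulr1; lra.
Qed.

(* Here walks are confined to heights at most [H]. The hypothesis [X1] says that
   the loops which leave [[:: true]] and come back to it have total weight at
   least one at [z], and this alone forces growth at least [z^-1]. *)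
Section LowerBound.
Variables (R : realFieldType) (z : R) (X Y : nat -> fps R) (H : nat).
Hypotheses (z_ge0 : 0 <= z) (X_ge0 : forall m n, 0 <= X m n)
  (Y_ge0 : forall m n, 0 <= Y m n).
Hypothesis Y_le : forall m n, (0 < m)%N ->
  Y m n <= (n == 0%N)%:R * (1 + z * X m.+1 0%N) + z * (fps_shift (X m.+1) * Y m) n.
Hypothesis X_le : forall m n, (0 < m)%N ->
  X m n <= Y m n + z * (Y m * fps_psum (X m.+1)) n.
Hypothesis X_big : forall m n, (H <= m)%N -> X m n = 0.
Hypothesis X1 : 1 <= z * X 1 1.

Local Notation V := (potential X Y 0 1).
Local Notation D := (descent Y 0 1).
Local Notation E := (landing Y 0 1).
Local Notation U := (unmarked_sum X Y 0 1).

Lemma fps_mul_ge0 (f g : fps R) n :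
  (forall i, 0 <= f i) -> (forall i, 0 <= g i) -> 0 <= (f * g) n.
Proof. by move=> f0 g0; apply: sumr_ge0 => i _; apply: mulr_ge0. Qed.

Lemma fps_mul_le (f f' g : fps R) n :
  (forall i, f i <= f' i) -> (forall i, 0 <= g i) -> (f * g) n <= (f' * g) n.
Proof. by move=> ff g0; apply: ler_sum => i _; apply: ler_wpM2r. Qed.

Lemma descent_ge0 s j : 0 <= D s j.
Proof.
elim: s j => [|b s IH] j //=.
have E_ge0 i : 0 <= lift_level Y 1 (size s) (D s) i.
  rewrite /lift_level; case: (size s) => [|n]; first by rewrite /= ler0n.
  exact: fps_mul_ge0.
by case: b => //=; case: ifP.
Qed.

Lemma landing_ge0 s j : 0 <= E s j.
Proof.
rewrite /landing /lift_level; case: (size s) => [|n]; first by rewrite /= ler0n.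
by apply: fps_mul_ge0 => // i; apply: descent_ge0.
Qed.

Lemma potential_ge0 s : 0 <= V s.
Proof. by apply: fps_mul_ge0 => // i; apply: descent_ge0. Qed.

Lemma landing_le s j : E s j <=
  D s j + z * (X (size s).+1 0%N * D s j + (fps_shift (X (size s).+1) * E s) j).
Proof.
case: s => [|b s].
  (* At the boundary the descent is 0 and the landing is 1, so the inequality is exactly [X1]. *)
  rewrite -[E [::]]/(1 : fps R) -[D [::]]/(0 : fps R) coef_fps0 mulr0 !add0r.
  rewrite mulr1 coef_fps1; case: j => [|j]; first exact: X1.
  by rewrite mulr_ge0 //; apply: X_ge0.
set v := b :: s; set m := size v; have m0 : (0 < m)%N by [].
pose Y' : fps R := fpsC (1 + z * X m.+1 0%N) + fpsC z * (fps_shift (X m.+1) * Y m).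
apply: (@le_trans _ _ ((Y' * D v) j)).
  apply: fps_mul_le => [i|i]; last exact: descent_ge0.
  rewrite (le_trans (Y_le i m0)) // coef_fpsD coef_fpsCM lerD2r.
  by case: i => [|i] /=; rewrite ?mul1r ?mul0r.
rewrite mulrDl coef_fpsD coef_fpsCM -!mulrA coef_fpsCM -/(E v) mulrDl mul1r.
by rewrite -addrA lerD2l mulrDr lerD2r mulrA.
Qed.

Lemma descent_le s : D s (count id s) <= z * U s.
Proof.
elim: s => [|b s IH]; first by rewrite /unmarked_sum big_ord0 mulr0.
rewrite unmarked_sum_cons; case: b => /=.
  by rewrite eqxx add0r.
rewrite add0n -/(E s) (le_trans (landing_le _ _)) // potential_true.
by rewrite [leRHS]mulrDr addrC lerD2l.
Qed.

Lemma potential_le s : V s <= z * \sum_(v < (size s).+2) V (child s v).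
Proof.
rewrite sum_child_potential.
have le1 : V s <= E s (count id s)
    + z * (fps_psum (X (size s).+1) * E s) (count id s).
  case: s => [|b s].
    rewrite /potential mulr0 coef_fps0 addr_ge0 ?landing_ge0 // mulr_ge0 //.
    by apply: fps_mul_ge0 => i; [apply: sumr_ge0|apply: landing_ge0].
  set v := b :: s; set m := size v; have m0 : (0 < m)%N by [].
  pose X' : fps R := Y m + fpsC z * (Y m * fps_psum (X m.+1)).
  apply: (@le_trans _ _ ((X' * D v) (count id v))).
    apply: fps_mul_le => [i|i]; last exact: descent_ge0.
    by rewrite (le_trans (X_le i m0)) // coef_fpsD coef_fpsCM.
  by rewrite mulrDl coef_fpsD -mulrA coef_fpsCM -mulrA [in leLHS]mulrCA.
have le2 := landing_le s (count id s); have le3 := descent_le s.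
apply: (le_trans le1); rewrite !mulrDr; rewrite mulrDr in le2.
move: le2 le3.
set a := E s _; set b := D s _; set c := z * _; set d := z * _.
set e := z * _; set f := z * _ => *; lra.
Qed.

(** There are finitely many states of size below [H], and on the others the potential vanishes. *)
Lemma potential_bounded : exists M, forall s, V s <= M.
Proof.
exists (\sum_(m < H) \sum_(t : m.-tuple bool) V t) => s.
have sum_ge0 m : 0 <= \sum_(t : m.-tuple bool) V t.
  by apply: sumr_ge0 => t _; apply: potential_ge0.
have [sH|sH] := ltnP (size s) H; last first.
  rewrite [V s](_ : _ = 0) ?sumr_ge0 //.
  by apply: big1 => i _; rewrite X_big ?mul0r.
rewrite (bigD1 (Ordinal sH)) //= (bigD1 (in_tuple s)) //= -addrA lerDl.
by apply: addr_ge0; apply: sumr_ge0 => i _; [apply: potential_ge0|apply: sum_ge0].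
Qed.

Lemma tree_count_ge M n s : (forall s, V s <= M) ->
  V s <= M * z ^+ n * (tree_count n s)%:R.
Proof.
move=> VM; elim: n s => [|n IH] s; first by rewrite expr0 !mulr1.
rewrite (le_trans (potential_le s)) // tree_countS exprS.
rewrite mulrCA -!mulrA ler_wpM2l // mulrA mulr_sumr.
by apply: ler_sum => v _; apply: IH.
Qed.

Lemma av4213_ge_potential : z <= 1 -> exists2 c : R, 0 < c &
  forall n, c <= z ^+ n * (av4213 n)%:R.
Proof.
move=> z1; have [M VM] := potential_bounded.
have z0 : 0 < z.
  rewrite lt_neqAle z_ge0 andbT; apply: contraTneq X1 => <-.
  by rewrite mul0r ler10.
have V0 : 0 < V [:: true].
  have -> : V [:: true] = X 1 1.
    rewrite potential_true -[E [::]]/(1 : fps R) -[D [::]]/(0 : fps R).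
    by rewrite coef_fps0 mulr0 add0r mulr1.
  rewrite lt_neqAle X_ge0 andbT; apply: contraTneq X1 => <-.
  by rewrite mulr0 ler10.
have M0 : 0 < M by apply: lt_le_trans V0 (VM _).
(* The factor [z ^+ 2] pays for the two entries that lead to [[:: true]]; for lengths 0 and 1 the
   estimate follows from [z <= 1]. *)
exists (z ^+ 2 * (V [:: true] / M)); first by rewrite mulr_gt0 ?exprn_gt0 ?divr_gt0.
have le1 : V [:: true] / M <= 1 by rewrite ler_pdivrMr ?mul1r.
have ge0 : 0 <= V [:: true] / M by rewrite divr_ge0 ?ltW.
move=> [|[|n]].
- have -> : av4213 0 = 1%N.
    rewrite /av4213 size_filter /=; case: asboolP => //.
    by case=> w [x [y [t [/size_subseq]]]].
  by rewrite expr0 mulr1 mulr_ile1 ?exprn_ile1 ?exprn_ge0.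
- by rewrite av4213S expr1 exprS expr1 -mulrA ler_wpM2l // mulr_ile1.
rewrite av4213S -[in leRHS](add2n n) exprD -mulrA ler_wpM2l ?exprn_ge0 //.
rewrite ler_pdivrMr // (le_trans (tree_count_ge n _ VM)) //.
rewrite -mulrA mulrC ler_wpM2r ?(ltW M0) // ler_wpM2l ?exprn_ge0 //.
by rewrite ler_nat /= big_ord_recr leq_addl.
Qed.
End LowerBound.

(** * A certificate for the lower bound *)

(* The kernel equations at [z = 20/153], truncated at degree 8 and solved from
   the top height down in fixed point with rounding towards zero; 39 heights
   are enough for the loops at height 1 to reach total weight one. *)
Definition scaleN : N := 100000%num.

Definition sumN (f : nat -> N) (n : nat) : N :=
  foldr (fun i a => N.add (f i) a) 0%num (iota 0 n).

Definition convN (f g : nat -> N) (n : nat) : N :=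
  sumN (fun i => N.mul (f i) (g (n - i)%N)) n.+1.

Definition psumN (f : nat -> N) (n : nat) : N := sumN f n.+1.

Definition unitN (x : seq N) (n : nat) : N :=
  if n is 0%N then
    N.add (N.mul 153 (N.mul scaleN scaleN))
          (N.mul 20 (N.mul scaleN (nth 0%num x 0)))
  else 0%num.

(** The convolution for [y n] contains the term [x 1 * y n]; moving it to the left gives [den], and
    only earlier coefficients remain. *)
Definition step_landing (x : seq N) : seq N :=
  let den := N.sub (N.mul 153 scaleN) (N.mul 20 (nth 0%num x 1)) in
  foldl (fun y n => rcons y (N.div
      (N.add (unitN x n)
         (N.mul 20 (sumN (fun i => N.mul (nth 0%num x i.+2)
                                         (nth 0%num y (n - i.+1)%N)) n))) den))
    [::] (iota 0 9).

Definition step_descent (x y : seq N) : seq N :=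
  mkseq (fun n => N.div (N.add (N.mul (N.mul 153 scaleN) (nth 0%num y n))
     (N.mul 20 (convN (nth 0%num y) (psumN (nth 0%num x)) n)))
     (N.mul 153 scaleN)) 9.

Fixpoint levels (n : nat) : seq (seq N * seq N) :=
  if n is n'.+1 then
    let l := levels n' in
    let x := (head ([::], [:: scaleN]) l).1 in
    let y := step_landing x in
    (step_descent x y, y) :: l
  else [::].

(** The inequality [Y_le] at [z = 20/153], made integral by the factor [153 * scaleN ^ 2]. *)
Definition check_landing (x y : seq N) (n : nat) : bool :=
  N.leb (N.mul (N.mul 153 scaleN) (nth 0%num y n))
    (N.add (unitN x n)
       (N.mul 20 (convN (fun i => nth 0%num x i.+1) (nth 0%num y) n))).

Definition check_descent (x y x' : seq N) (n : nat) : bool :=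
  N.leb (N.mul (N.mul 153 scaleN) (nth 0%num x' n))
    (N.add (N.mul (N.mul 153 scaleN) (nth 0%num y n))
       (N.mul 20 (convN (nth 0%num y) (psumN (nth 0%num x)) n))).

Definition check_level (x : seq N) (l : seq N * seq N) : bool :=
  [&& size l.1 <= 9, size l.2 <= 9,
      all (check_landing x l.2) (iota 0 9)
    & all (check_descent x l.2 l.1) (iota 0 9)]%N.

(** Above the top height, [X = 0] and [Y = 1] satisfy both inequalities, so this level can be
    repeated indefinitely. *)
Definition level0 : seq N * seq N := ([::], [:: scaleN]).

Fixpoint check_levels (l : seq (seq N * seq N)) : bool :=
  if l is xy :: l' then check_level (head level0 l').1 xy && check_levels l'
  else true.

(** The inequalities are checked on the computed list itself, so no rounding error has to be
    estimated. The list starts at height 1, and the second condition becomes [X1]. *)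
Lemma levels_ok : exists2 l, check_levels l &
  N.leb (N.mul 153 scaleN) (N.mul 20 (nth 0%num (head level0 l).1 1)).
Proof. by exists (levels 39); vm_compute. Qed.

Section Certificate.
Variables (R : realFieldType) (l : seq (seq N * seq N)).
Hypothesis l_ok : check_levels l.

(* [locked] keeps the conversion to unary numbers from being computed. *)
Definition natN (n : N) : R := locked (N.to_nat n)%:R.

Lemma natNE n : natN n = (N.to_nat n)%:R.
Proof. by rewrite /natN -lock. Qed.

Lemma natN_add a b : natN (N.add a b) = natN a + natN b.
Proof. by rewrite !natNE N2Nat.inj_add natrD. Qed.

Lemma natN_mul a b : natN (N.mul a b) = natN a * natN b.
Proof. by rewrite !natNE N2Nat.inj_mul natrM. Qed.

Lemma natN_le a b : N.leb a b -> natN a <= natN b.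
Proof.
move=> /N.leb_le ab; rewrite -(N.sub_add _ _ ab) natN_add lerDr.
by rewrite natNE ler0n.
Qed.

Lemma natN_ge0 a : 0 <= natN a. Proof. by rewrite natNE ler0n. Qed.

Lemma natN0 : natN 0%num = 0. Proof. by rewrite natNE. Qed.

Lemma natN153 : natN 153%num = 153. Proof. by rewrite natNE. Qed.
Lemma natN20 : natN 20%num = 20. Proof. by rewrite natNE. Qed.

Lemma natN_sum f n : natN (sumN f n) = \sum_(i < n) natN (f i).
Proof.
rewrite -(big_mkord xpredT (fun i => natN (f i))) /sumN /index_iota subn0.
by elim: (iota 0 n) => [|i r IH]; rewrite ?big_nil ?big_cons /= ?natN0 // natN_add IH.
Qed.

Lemma natN_conv f g n :
  natN (convN f g n) = \sum_(i < n.+1) natN (f i) * natN (g (n - i)%N).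
Proof. by rewrite natN_sum; apply: eq_bigr => i _; rewrite natN_mul. Qed.

Definition fps_of (x : seq N) : fps R :=
  Fps (fun n => natN (nth 0%num x n) / natN scaleN).

Let s := natN scaleN.
Lemma scale_gt0 : 0 < natN scaleN.
Proof. by rewrite natNE ltr0n; apply/ssrnat.ltP; exact: Pos2Nat.is_pos. Qed.
Let s_gt0 : 0 < s := scale_gt0.

Definition lev (m : nat) : seq N * seq N :=
  if m is m'.+1 then nth level0 l m' else level0.

Lemma check_lev m : (0 < m)%N -> check_level (lev m.+1).1 (lev m).
Proof.
have ok0 : check_level [::] level0 by vm_compute.
case: m => // m _; rewrite /lev; elim: m l l_ok => [|m IH] [|xy l'] //.
- by case/andP; rewrite /= nth0.
- by case/andP=> _ /IH.
Qed.

Lemma lev_landing m n : (0 < m)%N -> fps_of (lev m).2 n <=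
  (n == 0%N)%:R * (1 + 20 / 153 * fps_of (lev m.+1).1 0%N)
  + 20 / 153 * (fps_shift (fps_of (lev m.+1).1) * fps_of (lev m).2) n.
Proof.
move=> m0; have /and4P[_ sy /allP chk _] := check_lev m0.
set x := (lev m.+1).1; set y := (lev m).2.
have rhs_ge0 : 0 <= (fps_shift (fps_of x) * fps_of y) n.
  by apply: fps_mul_ge0 => i; rewrite divr_ge0 // natN_ge0.
have [n9|n9] := ltnP n 9; last first.
  rewrite /fps_of /= nth_default ?natN0 ?mul0r ?(leq_trans sy) //.
  case: n n9 rhs_ge0 => [//|n _ ge0]; rewrite mul0r add0r.
  by rewrite mulr_ge0 ?ge0 //; lra.
have := natN_le (chk n _); rewrite mem_iota n9 => /(_ isT).
rewrite natN_add (natN_mul 20) natN_conv (natN_mul (N.mul _ _)) (natN_mul 153) -/s.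
have -> : \sum_(i < n.+1)
    natN (nth 0%num x i.+1) * natN (nth 0%num y (n - i)%N) =
  s ^+ 2 * (fps_shift (fps_of x) * fps_of y) n.
  rewrite coef_fpsM mulr_sumr; apply: eq_bigr => i _; rewrite /= -/s.
  by field; rewrite gt_eqF.
have -> : natN (unitN x n) =
  153 * s ^+ 2 * ((n == 0%N)%:R * (1 + 20 / 153 * fps_of x 0%N)).
  case: n {n9 rhs_ge0} => [|n]; last by rewrite [unitN _ _]/= natN0 mul0r mulr0.
  rewrite /unitN !(natN_add, natN_mul) -/s /= -/s mul1r.
  rewrite natN153 natN20.
  by move: s s_gt0 (natN (nth _ _ _)) => u u0 a; field; rewrite gt_eqF.
have -> : natN (nth 0%num y n) = s * fps_of y n.
  by rewrite /= mulrC divfK // gt_eqF.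
rewrite natN153 natN20.
move: (fps_of y n) ((n == 0%N)%:R * _) ((_ * fps_of y) n) => a b c.
move: s s_gt0 => u u0 le.
have : 0 <= 153 * u ^+ 2 * (b + 20 / 153 * c - a) by lra.
by rewrite pmulr_rge0 ?subr_ge0 // mulr_gt0 // exprn_gt0.
Qed.

Lemma lev_descent m n : (0 < m)%N -> fps_of (lev m).1 n <=
  fps_of (lev m).2 n
  + 20 / 153 * (fps_of (lev m).2 * fps_psum (fps_of (lev m.+1).1)) n.
Proof.
move=> m0; have /and4P[sx _ _ /allP chk] := check_lev m0.
set x := (lev m.+1).1; set y := (lev m).2; set x' := (lev m).1.
have fps_ge0 u i : 0 <= fps_of u i by rewrite divr_ge0 // natN_ge0.
have rhs_ge0 : 0 <= (fps_of y * fps_psum (fps_of x)) n.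
  by apply: fps_mul_ge0 => // i; apply: sumr_ge0 => k _; apply: fps_ge0.
have [n9|n9] := ltnP n 9; last first.
  rewrite [fps_of x' n]/= nth_default ?natN0 ?mul0r ?(leq_trans sx) //.
  by rewrite addr_ge0 // mulr_ge0 //; lra.
have := natN_le (chk n _); rewrite mem_iota n9 => /(_ isT).
rewrite natN_add (natN_mul 20) natN_conv !(natN_mul (N.mul _ _)) (natN_mul 153) -/s.
have -> : \sum_(i < n.+1)
    natN (nth 0%num y i) * natN (psumN (nth 0%num x) (n - i)) =
  s ^+ 2 * (fps_of y * fps_psum (fps_of x)) n.
  rewrite coef_fpsM mulr_sumr; apply: eq_bigr => i _.
  rewrite natN_sum coef_psum /= -mulr_suml -/s.
  by field; rewrite gt_eqF.
have -> : natN (nth 0%num y n) = s * fps_of y n.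
  by rewrite /= mulrC divfK // gt_eqF.
have -> : natN (nth 0%num x' n) = s * fps_of x' n.
  by rewrite /= mulrC divfK // gt_eqF.
rewrite natN153 natN20.
move: (fps_of y n) (fps_of x' n) ((fps_of y * _) n) => a b c.
move: s s_gt0 => u u0 le.
have : 0 <= 153 * u ^+ 2 * (a + 20 / 153 * c - b) by lra.
by rewrite pmulr_rge0 ?subr_ge0 // mulr_gt0 // exprn_gt0.
Qed.

End Certificate.

Lemma av4213_ge (R : realFieldType) : exists2 c : R, 0 < c &
  forall n, c * (153 / 20) ^+ n <= (av4213 n)%:R.
Proof.
have [l ok ok1] := levels_ok.
have fps_ge0 u i : 0 <= fps_of R u i by rewrite divr_ge0 // natN_ge0.
have [||||||||c c0 le] := @av4213_ge_potential R (20 / 153)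
  (fun m => fps_of R (lev l m).1) (fun m => fps_of R (lev l m).2) (size l).+1.
- by lra.
- by move=> m n.
- by move=> m n.
- by move=> m n; apply: lev_landing.
- by move=> m n; apply: lev_descent.
- move=> m n hm; rewrite /lev; case: m hm => // m hm.
  by rewrite nth_default //= nth_nil natN0 mul0r.
- have := natN_le R ok1.
  rewrite !natN_mul natN153 natN20 => le.
  have s0 : 0 < natN R scaleN by exact: scale_gt0.
  rewrite /= mulrA ler_pdivlMr // mul1r.
  rewrite nth0.
  lra.
- by lra.
exists c => // n; have := le n; rewrite -(ler_pM2l (x := (153 / 20) ^+ n)).
  rewrite mulrA -exprMn (_ : 153 / 20 * (20 / 153) = 1) ?expr1n ?mul1r 1?mulrC //.
  by field.
by rewrite exprn_gt0 //; lra.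
Qed.

(** * From 4213-avoiders to 54213-avoiders: the upper bound *)

Local Open Scope nat_scope.

Definition contains54213 (p : seq nat) : Prop :=
  exists v w x y z, subseq [:: v; w; x; y; z] p /\
    [&& y < x, x < z, z < w & w < v].

Definition avoiders54213 (n : nat) : seq (seq nat) :=
  [seq p <- permutations (iota 0 n) | ~~ `[< contains54213 p >]].

Definition av54213 (n : nat) : nat := size (avoiders54213 n).

Lemma mem_avoiders54213 n p : (p \in avoiders54213 n) =
  perm_eq p (iota 0 n) && ~~ `[< contains54213 p >].
Proof. by rewrite mem_filter mem_permutations andbC. Qed.

Lemma mem_avoiders4213 n p : (p \in avoiders4213 n) =
  perm_eq p (iota 0 n) && ~~ `[< contains4213 p >].
Proof. by rewrite mem_filter mem_permutations andbC. Qed.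

Fixpoint bits (n : nat) : seq bitseq :=
  if n is n'.+1 then map (cons true) (bits n') ++ map (cons false) (bits n')
  else [:: [::]].

Lemma mem_bits n b : (b \in bits n) = (size b == n).
Proof.
elim: n b => [|n IH] [|x b]; rewrite /= ?inE // mem_cat.
  by apply/negbTE/negP => /orP[] /mapP[].
have cons_inj y : injective (@cons bool y) by move=> u v [].
by case: x; rewrite (mem_map (@cons_inj _)) IH eqSS;
  [rewrite orb_idr|rewrite orb_idl] => // /mapP[].
Qed.

Lemma bits_uniq n : uniq (bits n).
Proof.
elim: n => //= n IH; rewrite cat_uniq !map_inj_uniq ?IH //;
  try by move=> u v [].
by rewrite andbT; apply/hasPn => _ /mapP[u _ ->]; apply/mapP => -[].
Qed.

Lemma sum_bits (A : comPzRingType) (w : A) n :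
  (\sum_(b <- bits n) w ^+ (n - count id b) = (1 + w) ^+ n)%R.
Proof.
elim: n => [|n IH]; first by rewrite big_seq1.
rewrite /= big_cat !big_map exprS mulrDl mul1r -IH mulr_sumr.
congr (_ + _)%R; rewrite big_seq [RHS]big_seq; apply: eq_bigr => b.
rewrite mem_bits => /eqP <- /=; rewrite add0n subSn ?count_size //.
by rewrite exprS.
Qed.

(* [b] bounds the entries read so far, so that [true] marks the left-to-right
   maxima of [p]. *)
Fixpoint maxima (b : nat) (p : seq nat) : bitseq :=
  if p is x :: q then (b <= x) :: maxima (maxn b x.+1) q else [::].

Lemma size_maxima b p : size (maxima b p) = size p.
Proof. by elim: p b => //= x p IH b; rewrite IH. Qed.

Lemma maxima_sorted b p :
  path.sorted ltn (mask (maxima b p) p) && all (leq b) (mask (maxima b p) p).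
Proof.
elim: p b => // x p IH b /=; have /andP[so al] := IH (maxn b x.+1).
have al' := sub_all _ al; have bx : all (leq b) (mask (maxima (maxn b x.+1) p) p).
  by apply: al' => y; rewrite geq_max => /andP[].
  case: leqP => le; last first.
    by rewrite so bx.
rewrite /= le bx andbT.
rewrite path_sortedE; last exact: ltn_trans.
by rewrite so (sub_all _ al) // => y; rewrite geq_max => /andP[_].
Qed.

(** An unmarked entry lies below the running bound, which comes either from the initial [b] or from
    an earlier entry. For [b = 0] only the latter is possible. *)
Lemma rest_below b p w s : uniq p ->
  subseq (w :: s) (mask (map negb (maxima b p)) p) ->
  w < b \/ exists2 v, w < v & subseq [:: v, w & s] p.
Proof.
elim: p b => //= x p IH b /andP[xp up].
case: (leqP b x) => [le|lt] /= sub.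
  have sub' : subseq (w :: s) p := subseq_trans sub (mask_subseq _ _).
  case: (IH _ up sub) => [|[v wv svp]]; last first.
    by right; exists v => //; apply: subseq_trans svp (subseq_cons _ _).
  have -> : maxn b x.+1 = x.+1 by lia.
  move=> wx; right; exists x; last by rewrite /= eqxx.
  have wp : w \in p by apply: (mem_subseq sub'); rewrite mem_head.
  have : w != x by apply: contraNneq xp => <-.
  by move: wx; lia.
move: sub; rewrite -/(subseq (w :: s) (x :: _)) subseq_consP => -[[-> _]|sub].
  by left.
rewrite (_ : maxn b x.+1 = b) in sub; last by lia.
case: (IH _ up sub) => [|[v wv svp]]; first by left.
by right; exists v => //; apply: subseq_trans svp (subseq_cons _ _).
Qed.

Definition rest (p : seq nat) : seq nat := mask (map negb (maxima 0 p)) p.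

(** A larger entry precedes the 4 of any 4213 among the non-maxima and serves as the 5. *)
Lemma rest_avoids p : uniq p -> ~ contains54213 p -> ~ contains4213 (rest p).
Proof.
move=> up av [w [x [y [z [sub lt]]]]]; apply: av.
case: (rest_below up sub) => // -[v wv svp].
by exists v, w, x, y, z; split=> //; rewrite wv; case/and3P: lt => -> -> ->.
Qed.

Definition standardize (r : seq nat) : seq nat :=
  [seq count (fun y => y < x) r | x <- r].

Lemma count_lt_mono (r : seq nat) x y : x \in r ->
  x < y -> count (fun u => u < x) r < count (fun u => u < y) r.
Proof.
move=> xr xy; have [r1 r2] := path.splitPr xr.
rewrite !count_cat /= ltnn xy add0n add1n addnS ltnS leq_add //;
  by apply: sub_count => u /= ux; apply: ltn_trans xy.
Qed.

Lemma count_ltE (r : seq nat) x y : x \in r -> y \in r ->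
  (count (fun u => u < x) r < count (fun u => u < y) r) = (x < y).
Proof.
move=> xr yr; apply/idP/idP => [|xy]; last exact: count_lt_mono.
apply: contraLR; rewrite -!leqNgt leq_eqVlt => /orP[/eqP->//|yx].
by apply: ltnW; apply: count_lt_mono.
Qed.

Lemma count_lt_inj (r : seq nat) :
  {in r &, injective (fun x => count (fun u => u < x) r)}.
Proof.
move=> x y xr yr /= e; have := count_ltE xr yr; have := count_ltE yr xr.
by rewrite e ltnn; lia.
Qed.

Lemma standardize_perm r : uniq r ->
  perm_eq (standardize r) (iota 0 (size r)).
Proof.
move=> ur; rewrite /standardize; set f := (fun x => _).
have uf : uniq (map f r) by rewrite map_inj_in_uniq //; apply: count_lt_inj.
apply: uniq_perm => //; first exact: iota_uniq.
have sub : {subset map f r <= iota 0 (size r)}; last first.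
  by have [] := uniq_min_size uf sub; rewrite ?size_iota ?size_map.
move=> _ /mapP[x xr ->].
rewrite mem_iota /f -[ltnRHS](count_predT).
have [r1 r2] := path.splitPr xr.
rewrite !count_cat /= ltnn add0n add1n addnS ltnS.
by rewrite leq_add // sub_count.
Qed.

Lemma standardize_avoids r : ~ contains4213 r -> ~ contains4213 (standardize r).
Proof.
move=> av [w [x [y [z [/subseq_mapP[] []]]]]] // a [|b [|c [|d []]]] //.
move=> [-> -> -> ->] sub lt; apply: av; exists a, b, c, d; split=> //.
have [ar br cr dr] : [/\ a \in r, b \in r, c \in r & d \in r].
  by split; apply: (mem_subseq sub); rewrite !inE eqxx ?orbT.
by move: lt; rewrite !count_ltE.
Qed.

Lemma standardize_inj r r' : perm_eq r r' ->
  standardize r = standardize r' -> r = r'.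
Proof.
move=> pr; rewrite /standardize.
rewrite (eq_map (g := fun x => count (fun u => u < x) r')); last first.
  by move=> x; apply/seq.permP.
apply: (inj_in_map (@count_lt_inj r')); apply/allP => x //.
by rewrite (perm_mem pr).
Qed.

Lemma size_mask_negb b (p : seq nat) : size b = size p ->
  size (mask (map negb b) p) = size p - count id b.
Proof.
move=> sb; rewrite size_mask ?size_map // count_map.
by have := count_predC id b; rewrite -sb => <-; rewrite addKn.
Qed.

Lemma mask_negb_inj (b : bitseq) (p q : seq nat) :
  size b = size p -> size b = size q -> mask b p = mask b q ->
  mask (map negb b) p = mask (map negb b) q -> p = q.
Proof.
elim: b p q => [|[] b IH] [|x p] [|y q] //= [sp] [sq].
  by move=> [-> e1] e2; rewrite (IH _ _ sp sq e1 e2).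
by move=> e1 [-> e2]; rewrite (IH _ _ sp sq e1 e2).
Qed.

Lemma perm_mask_negb (b : bitseq) (p : seq nat) : size b = size p ->
  perm_eq (mask b p ++ mask (map negb b) p) p.
Proof.
elim: b p => [|[] b IH] [|x p] //= [sp]; first by rewrite perm_cons IH.
by rewrite -cat1s perm_catCA /= perm_cons IH.
Qed.

Definition top_values n (p : seq nat) : bitseq :=
  [seq x \in mask (maxima 0 p) p | x <- iota 0 n].

Definition encode n (p : seq nat) : bitseq * bitseq * seq nat :=
  ((maxima 0 p, top_values n p), standardize (rest p)).

Lemma top_valuesE n p : perm_eq p (iota 0 n) ->
  mask (top_values n p) (iota 0 n) = mask (maxima 0 p) p.
Proof.
move=> pp; rewrite /top_values -filter_mask.
apply: (@irr_sorted_eq _ ltn); rewrite ?ltnn //.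
- exact: ltn_trans.
- exact: ltnn.
- by apply: sorted_filter (iota_ltn_sorted 0 n); apply: ltn_trans.
- by case/andP: (maxima_sorted 0 p).
- move=> x; rewrite mem_filter andb_idr // => /mem_mask.
  by rewrite (perm_mem pp).
Qed.

Lemma count_top_values n p : perm_eq p (iota 0 n) ->
  count id (top_values n p) = count id (maxima 0 p).
Proof.
move=> pp; rewrite -(size_mask (s := iota 0 n)) ?size_map //.
by rewrite top_valuesE // size_mask ?size_maxima.
Qed.

(** The maxima increase, so their positions and their set of values determine them. The set of the
    other values is then known, and [standardize] is injective on the arrangements of one set. *)
Lemma encode_inj n : {in [pred p | perm_eq p (iota 0 n)] &, injective (encode n)}.
Proof.
move=> p q /= pp pq [em et es].
have szp := perm_size pp; have szq := perm_size pq.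
have emask : mask (maxima 0 p) p = mask (maxima 0 q) q.
  by rewrite -(top_valuesE pp) -(top_valuesE pq) et.
apply: (@mask_negb_inj (maxima 0 p)); rewrite ?size_maxima //.
- by rewrite szp szq.
- by rewrite emask -em.
rewrite {2}em; apply: standardize_inj => //.
rewrite -(perm_cat2l (mask (maxima 0 p) p)).
rewrite {2}emask -/(rest p) -/(rest q).
have h u : perm_eq (mask (maxima 0 u) u ++ rest u) u.
  by apply: perm_mask_negb; rewrite size_maxima.
by rewrite (perm_trans (h p)) // (perm_trans pp) // perm_sym (perm_trans (h q)).
Qed.

Definition codes n : seq (bitseq * bitseq * seq nat) :=
  [seq (b, r) | b <- [seq b <- [seq (b1, b2) | b1 <- bits n, b2 <- bits n]
                          | count id b.1 == count id b.2],
                r <- avoiders4213 (n - count id b.1)].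

Lemma encode_codes n p : p \in avoiders54213 n -> encode n p \in codes n.
Proof.
rewrite mem_avoiders54213 => /andP[pp /asboolPn av].
have up : uniq p by rewrite (perm_uniq pp) iota_uniq.
have szp := perm_size pp; rewrite size_iota in szp.
apply/allpairsPdep; exists (maxima 0 p, top_values n p), (standardize (rest p)).
split=> //.
  rewrite mem_filter /= count_top_values // eqxx; apply/allpairsP.
  exists (maxima 0 p, top_values n p).
  by rewrite !mem_bits size_maxima size_map size_iota szp.
rewrite mem_avoiders4213; apply/andP; split; last first.
  by apply/asboolPn; apply: standardize_avoids; apply: rest_avoids.
rewrite -[X in iota 0 (X - _)]szp -size_mask_negb ?size_maxima //.
by apply: standardize_perm; apply: mask_uniq.
Qed.

(** By [sum_bits] the right-hand side is a sum over pairs of bit words. The pairs with equal counts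
    suffice, since [(w ^+ 2) ^+ k >= 8 ^+ k] dominates the number of 4213-avoiders of length [k]. *)
Lemma av54213_le (R : realFieldType) (w : R) n : (0 <= w)%R -> (8 <= w ^+ 2)%R ->
  ((av54213 n)%:R <= (1 + w) ^+ n * (1 + w) ^+ n :> R)%R.
Proof.
move=> w0 w8.
have le1 : av54213 n <= size (codes n).
  rewrite /av54213 -(size_map (encode n)); apply: uniq_leq_size.
    rewrite map_inj_in_uniq ?filter_uniq ?permutations_uniq //.
    move=> p q; rewrite !mem_avoiders54213 => /andP[pp _] /andP[pq _].
    exact: encode_inj.
  by move=> _ /mapP[p pav ->]; apply: encode_codes.
apply: (@le_trans _ _ (size (codes n))%:R%R); first by rewrite ler_nat.
rewrite -sum_bits mulr_suml size_allpairs_dep sumnE big_map natr_sum big_filter.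
rewrite big_mkcond big_allpairs_dep; apply: ler_sum => b1 _.
rewrite mulr_sumr; apply: ler_sum => b2 _ /=; case: eqP => [e|_]; last first.
  by rewrite mulr_ge0 ?exprn_ge0.
rewrite -e -exprMn -expr2 (le_trans (av4213_le _ _)) //.
by apply: lerXn2r; rewrite // nnegrE ?exprn_ge0 ?ler0n.
Qed.

(** * From 4213-avoiders to 54213-avoiders: gluing *)

Lemma subseq_drop_notin (T : eqType) (x : T) s p q :
  x \notin p -> subseq (x :: s) (p ++ q) -> subseq (x :: s) q.
Proof.
elim: p => //= y p IH; rewrite inE negb_or => /andP[xy xp].
by rewrite (negPf xy) => /(IH xp).
Qed.

Lemma subseq_filter_all (T : eqType) (a : pred T) s p :
  all a s -> subseq s p -> subseq s (seq.filter a p).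
Proof. by move=> sa sp; rewrite subseq_filter sa. Qed.

Lemma contains54213_map f p : {mono f : x y / x < y} ->
  contains54213 (map f p) -> contains54213 p.
Proof.
move=> fm [v [w [x [y [z [/subseq_mapP[] []]]]]]] // a [|b [|c [|d [|e []]]]] //.
move=> [-> -> -> -> ->] sub; rewrite !fm => lt.
by exists a, b, c, d, e.
Qed.

Definition direct_sum (p q : seq nat) : seq nat := p ++ map (addn (size p)) q.

(** A 54213 starts with its largest entry: from [p] it cannot reach the larger entries of the
    shifted [q], and from there it cannot return to [p]. *)
Lemma direct_sum_avoids m n p q : p \in avoiders54213 m ->
  q \in avoiders54213 n -> direct_sum p q \in avoiders54213 (m + n).
Proof.
rewrite !mem_avoiders54213 => /andP[pp /asboolPn avp] /andP[pq /asboolPn avq].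
have szp := perm_size pp; rewrite size_iota in szp.
have mem_p x : (x \in p) = (x < m) by rewrite (perm_mem pp) mem_iota.
apply/andP; split.
  by rewrite /direct_sum iotaD szp add0n -[m]addn0 iotaDl addn0 perm_cat // perm_map.
apply/asboolPn => -[v [w [x [y [z [sub lt]]]]]].
have [vm|vm] := ltnP v m.
  apply: avp; exists v, w, x, y, z; split=> //.
  have : all (fun u => u < m) [:: v; w; x; y; z] by rewrite /=; lia.
  move=> /subseq_filter_all/(_ sub); rewrite filter_cat (@eq_in_filter _ _ predT).
    rewrite filter_predT (@eq_in_filter _ _ pred0) ?filter_pred0 ?cats0 //.
    by move=> _ /mapP[u _ ->]; rewrite szp /=; lia.
  by move=> u; rewrite mem_p.
apply: avq; apply: (@contains54213_map (addn (size p))).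
  by move=> a b; rewrite ltn_add2l.
exists v, w, x, y, z; split=> //.
by apply: subseq_drop_notin sub; rewrite mem_p -leqNgt.
Qed.

Lemma av54213_superadditive m n : av54213 m * av54213 n <= av54213 (m + n).
Proof.
rewrite /av54213 -(size_allpairs direct_sum); apply: uniq_leq_size.
  apply: allpairs_uniq; rewrite ?filter_uniq ?permutations_uniq //.
  move=> [p q] [p' q'] /allpairsP[[a b] [/= am _ [-> ->]]].
  move=> /allpairsP[[a' b'] [/= am' _ [-> ->]]].
  have sz u : u \in avoiders54213 m -> size u = m.
    by rewrite mem_avoiders54213 => /andP[/perm_size ->]; rewrite size_iota.
  move/eqP; rewrite /direct_sum eqseq_cat !sz // => /andP[/eqP-> /eqP e].
  by rewrite (inj_map _ e) // => x y /addnI.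
by move=> _ /allpairsP[[p q] [/= pm qn ->]]; apply: direct_sum_avoids.
Qed.

Lemma iota_avoids n : iota 0 n \in avoiders54213 n.
Proof.
rewrite mem_avoiders54213 perm_refl; apply/asboolPn => -[v [w [x [y [z [sub lt]]]]]].
have := subseq_sorted ltn_trans sub (iota_ltn_sorted 0 n) => /=; lia.
Qed.

Lemma av54213_gt0 n : 0 < av54213 n.
Proof.
rewrite /av54213 -has_predT; apply/hasP; exists (iota 0 n) => //.
exact: iota_avoids.
Qed.

(** The default 0 is not reached when the counts of [w] match the lengths of [xs] and [ys]. *)
Fixpoint weave (w : bitseq) (xs ys : seq nat) : seq nat :=
  match w with
  | [::] => [::]
  | true :: w' => head 0 xs :: weave w' (behead xs) ys
  | false :: w' => head 0 ys :: weave w' xs (behead ys)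
  end.

Lemma size_weave w xs ys : size (weave w xs ys) = size w.
Proof. by elim: w xs ys => [|[] w IH] xs ys //=; rewrite IH. Qed.

Lemma mask_weave w xs ys : count id w = size xs -> count negb w = size ys ->
  mask w (weave w xs ys) = xs /\ mask (map negb w) (weave w xs ys) = ys.
Proof.
elim: w xs ys => [|[] w IH] xs ys /=; rewrite ?add0n ?add1n.
- by case: xs => //; case: ys.
- by case: xs => //= x xs [c] c'; have [-> ->] := IH xs ys c c'.
- by case: ys => //= y ys c [c']; have [-> ->] := IH xs ys c c'.
Qed.

Lemma count_negb (w : bitseq) : count negb w = size w - count id w.
Proof.
have <- : count id w + count negb w = size w := count_predC id w.
by rewrite addKn.
Qed.

Lemma map_weave (a : pred nat) w xs ys : count id w = size xs ->
  count negb w = size ys -> all a xs -> all (predC a) ys ->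
  map a (weave w xs ys) = w.
Proof.
elim: w xs ys => [|[] w IH] xs ys //=; rewrite ?add0n ?add1n.
- by case: xs => //= x xs [c] c' /andP[-> ax] ay; rewrite IH.
- by case: ys => //= y ys c [c'] ax /andP[/negPf-> ay]; rewrite IH.
Qed.

Lemma map_mem_mask (v : bitseq) (p : seq nat) : uniq p -> size v = size p ->
  [seq x \in mask v p | x <- p] = v.
Proof.
elim: v p => [|b v IH] [|x p] //= /andP[xp up] [sz].
rewrite -[in RHS](IH _ up sz); congr (_ :: _).
  by case: b; rewrite ?mem_head //; apply: contraNF xp => /mem_mask.
apply/eq_in_map => y yp; case: b => //; rewrite inE.
by have -> : (y == x) = false by apply: contraNF xp => /eqP <-.
Qed.

Lemma subseq_drop_sorted a b s (p q : seq nat) : path.sorted ltn p -> b < a ->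
  subseq [:: a, b & s] (p ++ q) -> subseq (b :: s) q.
Proof.
elim: p => [_ _|x p IH xp ba].
  by apply: subseq_trans; apply: subseq_cons.
have := xp; rewrite /= path_sortedE; last exact: ltn_trans.
move=> /andP[xal so].
move=> /subseq_consP[[ax sub]|]; last exact: IH.
apply: subseq_drop_notin sub; apply/negP => bp.
by have := allP xal _ bp => /=; move: ba; rewrite ax; lia.
Qed.

(** The entries of [p] above [M] increase, so the descent from [a] to [b] forces [b], and with it
    all that follows, into [q]. *)
Lemma subseq_high_all M a b s (p q : seq nat) :
  path.sorted ltn (seq.filter (ltn M) p) -> all (ltn M) q -> M < b < a ->
  subseq [:: a, b & s] (p ++ q) -> all (ltn M) s.
Proof.
move=> so aq Mba; elim: p so => [_|x p IH so].
  move=> /mem_subseq sub; apply/allP => y ys; apply: (allP aq); apply: sub.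
  by rewrite !inE ys !orbT.
move=> /subseq_consP[[ax sub]|sub]; last first.
  apply: (IH _ sub); move: so => /=; case: ifP => // _.
  exact: path_sorted.
have bp : b \notin p.
  apply/negP => bp; move: so => /=; rewrite ifT; last by rewrite -ax /=; lia.
  rewrite /= path_sortedE; last exact: ltn_trans.
  move=> /andP[/allP/(_ b)] + _; rewrite mem_filter bp andbT /=.
  by move=> /(_ _); rewrite -ax; lia.
have sub' := subseq_drop_notin bp sub.
apply/allP => y ys; apply: (allP aq); apply: (mem_subseq sub').
by rewrite inE ys orbT.
Qed.

Section Glue.
Variables (M j : nat).

Definition low_rest (v : bitseq) : seq nat := mask (map negb v) (iota 0 M).

(* The entries of [p] are shifted above [M]. A copy of [s] is put below them and
   its positions are interleaved, following [w], with the first [j] entries of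
   [p]; it is covered by new left-to-right maxima whose values are interleaved
   with its own following [v]. The forced last maximum [M] exceeds all of [s],
   so that every choice of [w] and [v] is allowed. *)
Definition glue (w v : bitseq) (s p : seq nat) : seq nat :=
  rcons (mask v (iota 0 M)) M
  ++ weave w (map (addn M.+1) (take j p)) (map (nth 0 (low_rest v)) s)
  ++ map (addn M.+1) (drop j p).

(** The first [j] entries must increase for the interleaving to be free; [glue] provides [j]
    increasing first entries again for the next round. *)
Definition glueable (n : nat) : pred (seq nat) :=
  [pred p | [&& p \in avoiders54213 n, j <= n & path.sorted ltn (take j p)]].

Variables (n : nat) (w v : bitseq) (s p : seq nat).
Hypotheses (wM : size w = M) (wj : count id w = j)
  (vM : size v = M) (vj : count id v = j)
  (s_av : s \in avoiders4213 (M - j)) (p_gl : glueable n p).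

Let xs := map (addn M.+1) (take j p).
Let ys := map (nth 0 (low_rest v)) s.
Let W := weave w xs ys.
Let T := map (addn M.+1) (drop j p).

Let size_p : size p = n.
Proof.
case/and3P: p_gl; rewrite mem_avoiders54213 => /andP[/perm_size -> _] _ _.
by rewrite size_iota.
Qed.

Let size_s : size s = M - j.
Proof.
move: s_av; rewrite mem_avoiders4213 => /andP[/perm_size -> _].
by rewrite size_iota.
Qed.

Let size_xs : size xs = j.
Proof. by rewrite size_map size_takel // size_p; case/and3P: p_gl. Qed.

Let size_ys : size ys = M - j.
Proof. by rewrite size_map. Qed.

Lemma low_rest_lt x : x \in low_rest v -> x < M.
Proof. by move/mem_mask; rewrite mem_iota. Qed.

Lemma size_low_rest : size (low_rest v) = M - j.
Proof. by rewrite size_mask_negb ?size_iota // vj. Qed.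

Let maskW : mask w W = xs /\ mask (map negb w) W = ys.
Proof. by apply: mask_weave; rewrite ?size_xs ?size_ys ?count_negb ?wM ?wj. Qed.

Let xs_gt x : x \in xs -> M < x.
Proof. by case/mapP=> u _ ->; lia. Qed.

Let T_gt x : x \in T -> M < x.
Proof. by case/mapP=> u _ ->; lia. Qed.

Let perm_ys : perm_eq ys (low_rest v).
Proof.
rewrite -[X in perm_eq _ X](take_size (low_rest v)).
rewrite -(map_nth_iota0 0 (leqnn _)) size_low_rest; apply: perm_map.
by move: s_av; rewrite mem_avoiders4213 => /andP[].
Qed.

Let ys_lt y : y \in ys -> y < M.
Proof. by rewrite (perm_mem perm_ys) => /low_rest_lt. Qed.

Let map_high : map (addn M.+1) p = xs ++ T.
Proof. by rewrite -map_cat cat_take_drop. Qed.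

Let highW : [seq M < x | x <- W] = w.
Proof.
apply: map_weave; rewrite ?size_xs ?size_ys ?count_negb ?wM ?wj //.
  by apply/allP.
by apply/allP => y /ys_lt /= ym; rewrite -leqNgt ltnW.
Qed.

Let filter_high : seq.filter (ltn M) W = xs.
Proof. by rewrite filter_mask highW; case: maskW. Qed.

Let filter_low : seq.filter (predC (ltn M)) W = ys.
Proof.
rewrite filter_mask (eq_map (g := negb \o ltn M)) // map_comp highW.
by case: maskW.
Qed.

Lemma glue_perm : perm_eq (glue w v s p) (iota 0 (M.+1 + n)).
Proof.
have pp : perm_eq p (iota 0 n).
  by case/and3P: p_gl; rewrite mem_avoiders54213 => /andP[].
have e1 : perm_eq (xs ++ ys) W.
  have [{1}<- {1}<-] := maskW; apply: perm_mask_negb.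
  by rewrite size_weave.
have e2 : perm_eq (mask v (iota 0 M) ++ low_rest v) (iota 0 M).
  by apply: perm_mask_negb; rewrite size_iota.
have e3 : perm_eq (xs ++ T) (iota M.+1 n).
  by rewrite -map_high -[in iota _ n](addn0 M.+1) iotaDl perm_map.
apply/seq.permP => a; move/seq.permP/(_ a): e1; move/seq.permP/(_ a): e2.
move/seq.permP/(_ a): e3; move/seq.permP/(_ a): perm_ys.
rewrite /glue -cats1 addSnnS iotaD add0n -/xs -/ys -/W -/T !count_cat /=.
lia.
Qed.

Lemma glue_avoids : ~ contains54213 (glue w v s p).
Proof.
have sA : path.sorted ltn (rcons (mask v (iota 0 M)) M).
  rewrite -cats1 -[M in [:: M]]add0n.
  apply: (subseq_sorted ltn_trans _ (iota_ltn_sorted 0 M.+1)).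
  by rewrite -addn1 iotaD cat_subseq ?mask_subseq.
have A_le x : x \in rcons (mask v (iota 0 M)) M -> x <= M.
  by rewrite mem_rcons inE => /orP[/eqP->//|/mem_mask]; rewrite mem_iota; lia.
move=> [a [b [c [d [e [sub lt]]]]]].
(* Here [b] plays the 4. If [b <= M], then [b], [c], [d], [e] form a 4213 in the copy of [s].
   Otherwise [a] and [b] exceed [M], hence so do the others by [subseq_high_all], and the whole
   occurrence lies in the shifted [p]. *)
have [bM|bM] := leqP b M.
  have sub1 : subseq [:: b; c; d; e] (W ++ T).
    by apply: subseq_drop_sorted sA _ sub; lia.
  have al : all (predC (ltn M)) [:: b; c; d; e] by rewrite /=; lia.
  have := subseq_filter_all al sub1.
  rewrite filter_cat filter_low (@eq_in_filter _ _ pred0 T) ?filter_pred0 ?cats0.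
    move=> /subseq_mapP[] [|b' [|c' [|d' [|e' []]]]] //= [eb ec ed ee] sub2.
    move: s_av; rewrite mem_avoiders4213 => /andP[ps /asboolPn]; apply.
    exists b', c', d', e'; split=> //.
    have in_s x : x \in [:: b'; c'; d'; e'] -> x < size (low_rest v).
      move=> /(mem_subseq sub2).
      by rewrite (perm_mem ps) mem_iota size_low_rest.
    have nth_lt x y : x \in [:: b'; c'; d'; e'] -> y \in [:: b'; c'; d'; e'] ->
        nth 0 (low_rest v) x < nth 0 (low_rest v) y -> x < y.
      move=> /in_s xs' /in_s ys'; rewrite !ltnNge; apply: contra => yx.
      apply: sorted_leq_nth => //; first exact: leq_trans.
      by apply: (subseq_sorted leq_trans (mask_subseq _ _)); apply: iota_sorted.
    move: lt; rewrite eb ec ed ee => /and4P[l1 l2 l3 _].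
    by apply/and3P; split; apply: nth_lt; rewrite // !inE eqxx ?orbT.
  by move=> x /T_gt /=; lia.
have sub1 : subseq [:: a; b; c; d; e] (W ++ T).
  by apply: subseq_drop_notin sub; apply/negP => /A_le; lia.
have aT : all (ltn M) T by apply/allP.
have p_sorted : path.sorted ltn (take j p) by case/and3P: p_gl.
have al : all (ltn M) [:: c; d; e].
  apply: subseq_high_all aT _ sub1; last by lia.
  by rewrite filter_high /xs sorted_map; apply: sub_sorted p_sorted => x y /=; lia.
have al' : all (ltn M) [:: a; b; c; d; e].
  by move: al => /= ->; rewrite andbT; lia.
have := subseq_filter_all al' sub1.
rewrite filter_cat filter_high (all_filterP aT) -map_high => sub2.
case/and3P: p_gl; rewrite mem_avoiders54213 => /andP[_ /asboolPn avp] _ _.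
apply: avp; apply: (@contains54213_map (addn M.+1)).
  by move=> x y; rewrite ltn_add2l.
by exists a, b, c, d, e.
Qed.

Lemma glue_glueable : glueable (M.+1 + n) (glue w v s p).
Proof.
have sv : size (mask v (iota 0 M)) = j by rewrite size_mask ?size_iota.
have jM : j <= M by rewrite -vj -vM count_size.
apply/and3P; split.
- by rewrite mem_avoiders54213 glue_perm; apply/asboolPn/glue_avoids.
- by lia.
rewrite /glue -cats1 -!catA take_cat sv ltnn subnn take0 cats0.
exact: (subseq_sorted ltn_trans (mask_subseq _ _) (iota_ltn_sorted 0 M)).
Qed.

(** The word consists of [j] new maxima, the entry [M], a woven stretch of length [M] and the end of
    [p]; within the stretch, comparison with [M] separates [p] from [s]. *)
Lemma glueK : [/\ v = [seq x \in take j (glue w v s p) | x <- iota 0 M],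
  w = [seq M < x | x <- take M (drop j.+1 (glue w v s p))],
  ys = seq.filter (predC (ltn M)) (take M (drop j.+1 (glue w v s p)))
  & map (addn M.+1) p = seq.filter (ltn M) (take M (drop j.+1 (glue w v s p)))
                        ++ drop M (drop j.+1 (glue w v s p)) ].
Proof.
have sv : size (mask v (iota 0 M)) = j by rewrite size_mask ?size_iota.
have sA : size (rcons (mask v (iota 0 M)) M) = j.+1 by rewrite size_rcons sv.
have sW : size W = M by rewrite size_weave.
have -> : take j (glue w v s p) = mask v (iota 0 M).
  by rewrite /glue -cats1 -!catA take_cat sv ltnn subnn take0 cats0.
have -> : drop j.+1 (glue w v s p) = W ++ T.
  by rewrite /glue drop_cat sA ltnn subnn drop0.
rewrite take_cat drop_cat sW ltnn subnn take0 drop0 cats0.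
by split; rewrite ?map_mem_mask ?size_iota ?iota_uniq ?filter_low ?filter_high ?highW.
Qed.
End Glue.

Lemma glue_inj M j n w v s p w' v' s' p' :
  size w = M -> count id w = j -> size v = M -> count id v = j ->
  s \in avoiders4213 (M - j) -> glueable j n p ->
  size w' = M -> count id w' = j -> size v' = M -> count id v' = j ->
  s' \in avoiders4213 (M - j) -> glueable j n p' ->
  glue M j w v s p = glue M j w' v' s' p' -> [/\ w = w', v = v', s = s' & p = p'].
Proof.
move=> wM wj vM vj sav pgl wM' wj' vM' vj' sav' pgl' e.
have [e1 e2 e3 e4] := glueK wM wj vM vj sav pgl.
have [f1 f2 f3 f4] := glueK wM' wj' vM' vj' sav' pgl'.
rewrite -e in f1 f2 f3 f4.
have ev : v = v' by rewrite e1 f1.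
split=> //; first by rewrite e2 f2.
  have perm_s u : u \in avoiders4213 (M - j) -> perm_eq u (iota 0 (M - j)).
    by rewrite mem_avoiders4213 => /andP[].
  apply: (@inj_in_map _ _ (nth 0 (low_rest M v)) (gtn (M - j))).
  - move=> x y; rewrite !inE /= => xs ys /eqP.
    rewrite nth_uniq ?(size_low_rest vM vj) //; first by move/eqP.
    by apply: mask_uniq; apply: iota_uniq.
  - by apply/allP => x; rewrite (perm_mem (perm_s _ sav)) mem_iota.
  - by apply/allP => x; rewrite (perm_mem (perm_s _ sav')) mem_iota.
  - by rewrite {2}ev e3 f3.
by apply: (@inj_map _ _ (addn M.+1)); [apply: addnI|rewrite e4 f4].
Qed.

Definition bits_with M j : seq bitseq := [seq b <- bits M | count id b == j].

Definition glue_keys M j : seq (bitseq * bitseq * seq nat) :=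
  [seq (wv, s) | wv <- [seq (w, v) | w <- bits_with M j, v <- bits_with M j],
                 s <- avoiders4213 (M - j)].

Fixpoint glued M j r : seq (seq nat) :=
  if r is r'.+1 then
    [seq glue M j k.1.1 k.1.2 k.2 p | k <- glue_keys M j, p <- glued M j r']
  else [:: iota 0 j].

Lemma glue_keysP M j k : k \in glue_keys M j ->
  [/\ size k.1.1 = M, count id k.1.1 = j, size k.1.2 = M, count id k.1.2 = j
    & k.2 \in avoiders4213 (M - j)].
Proof.
move=> /allpairsP[[wv s] [/= /allpairsP[[w v] [/=]]]].
rewrite !mem_filter !mem_bits => /andP[/eqP wj /eqP wM] /andP[/eqP vj /eqP vM].
by move=> -> sav ->.
Qed.

Lemma glued_spec M j r :
  uniq (glued M j r) /\ {subset glued M j r <= glueable j (r * M.+1 + j)}.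
Proof.
elim: r => [|r [IHu IHs]].
  split=> // _ /[!inE] /eqP->; rewrite iota_avoids leqnn take_oversize ?size_iota //.
  exact: iota_ltn_sorted.
split; last first.
  move=> _ /allpairsP[[k p] [/= kk pp ->]].
  have [wM wj vM vj sav] := glue_keysP kk.
  by rewrite mulSn -addnA; apply: glue_glueable => //; apply: IHs.
apply: allpairs_uniq => //.
  apply: allpairs_uniq; rewrite ?filter_uniq ?permutations_uniq //.
    by apply: allpairs_uniq; rewrite ?filter_uniq ?bits_uniq // => -[? ?] [].
  by move=> [? ?] [].
move=> _ _ /allpairsP[[k p] [/= kk pp ->]] /allpairsP[[k' p'] [/= kk' pp' ->]] /=.
have [wM wj vM vj sav] := glue_keysP kk.
have [wM' wj' vM' vj' sav'] := glue_keysP kk'.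
move=> /(glue_inj wM wj vM vj sav (IHs _ pp) wM' wj' vM' vj' sav' (IHs _ pp')).
case: k k' {kk kk' wM wj vM vj sav wM' wj' vM' vj' sav'} => [[? ?] ?] [[? ?] ?] /=.
by case=> -> -> -> ->.
Qed.

(** Each round adds [M.+1] entries, one of them the forced maximum, and its choices can be recovered
    by [glue_inj]. *)
Lemma av54213_glue M j r :
  (size (bits_with M j) * size (bits_with M j) * av4213 (M - j)) ^ r
    <= av54213 (r * M.+1 + j).
Proof.
have [gu gs] := glued_spec M j r.
apply: (@leq_trans (size (glued M j r))).
  elim: r {gu gs} => //= r IH; rewrite size_allpairs expnS leq_mul //.
  by rewrite !size_allpairs.
by apply: uniq_leq_size => // p /gs /and3P[].
Qed.

(** * Translation to the pattern 12453 *)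

Definition complement_word (n : nat) (p : 'S_n) : seq nat :=
  [seq val (rev_ord (p i)) | i <- enum 'I_n].

Lemma complement_word_inj n : injective (@complement_word n).
Proof.
move=> p q e; apply/permP => i; apply: rev_ord_inj; apply: val_inj.
have : [seq rev_ord (p i) | i <- enum 'I_n] = [seq rev_ord (q i) | i <- enum 'I_n].
  by apply: (inj_map val_inj); rewrite -[LHS]map_comp -[RHS]map_comp; exact: e.
by move/eq_in_map/(_ i); rewrite mem_enum => ->.
Qed.

Lemma complement_word_perm n (p : 'S_n) : perm_eq (complement_word p) (iota 0 n).
Proof.
rewrite -val_enum_ord /complement_word map_comp; apply: perm_map.
apply: uniq_perm; rewrite ?enum_uniq //.
  rewrite map_inj_uniq ?enum_uniq // => i k /rev_ord_inj/perm_inj //.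
move=> i; rewrite mem_enum; apply/mapP; exists (p^-1 (rev_ord i))%g.
  by rewrite mem_enum.
by rewrite permKV rev_ordK.
Qed.

Lemma perm_complement_words n :
  perm_eq [seq complement_word p | p : 'S_n] (permutations (iota 0 n)).
Proof.
have u : uniq [seq complement_word p | p : 'S_n].
  by rewrite map_inj_uniq ?enum_uniq //; apply: complement_word_inj.
have sub : {subset [seq complement_word p | p : 'S_n] <= permutations (iota 0 n)}.
  by move=> _ /mapP[p _ ->]; rewrite mem_permutations complement_word_perm.
have [//|sz e] := uniq_min_size u sub.
  rewrite size_permutations ?iota_uniq // size_iota size_map -cardE.
  by rewrite card_Sn.
by apply: uniq_perm; rewrite ?permutations_uniq.
Qed.

Lemma subseq_enum_ord n (t : seq 'I_n) :
  path.sorted (fun i k : 'I_n => i < k) t -> subseq t (enum 'I_n).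
Proof.
move=> so; have -> : t = seq.filter [in t] (enum 'I_n); last exact: filter_subseq.
apply: (@irr_sorted_eq _ (fun i k : 'I_n => i < k)) => //.
- by move=> i k l; apply: ltn_trans.
- by move=> i; rewrite ltnn.
- apply: sorted_filter; first by move=> i k l; apply: ltn_trans.
  by have := iota_ltn_sorted 0 n; rewrite -val_enum_ord sorted_map.
- by move=> i; rewrite mem_filter mem_enum andbT.
Qed.

Lemma enum_ord_sorted n (t : seq 'I_n) : subseq t (enum 'I_n) ->
  path.sorted (fun i k : 'I_n => i < k) t.
Proof.
move=> /subseq_sorted; apply; first by move=> i k l; apply: ltn_trans.
by have := iota_ltn_sorted 0 n; rewrite -val_enum_ord sorted_map.
Qed.

Lemma pattern_val (a : 'I_5) : pattern12453 a = nth 0 [:: 0; 1; 3; 4; 2] a :> nat.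
Proof.
rewrite permE /fun12453 inordK //.
by case: a => [[|[|[|[|[|a]]]]] Ha].
Qed.

Lemma containsP n (p : 'S_n) :
  contains p pattern12453 <-> contains54213 (complement_word p).
Proof.
split.
  move=> /existsP[f /andP[/forallP incr /forallP iso]].
  have lt (a b : 'I_5) : a < b -> f a < f b.
    by move=> ab; have /forallP/(_ b)/implyP := incr a; apply.
  have ltp (a b : 'I_5) : (p (f a) < p (f b)) = (pattern12453 a < pattern12453 b).
    by have /forallP/(_ b)/eqP := iso a.
  pose o k (h : k < 5) : 'I_5 := Ordinal h.
  pose g (k : 'I_5) := val (rev_ord (p (f k))).
  exists (g (@o 0 isT)), (g (@o 1 isT)), (g (@o 2 isT)), (g (@o 3 isT)),
    (g (@o 4 isT)); split.
    rewrite -[X in subseq X]/(map (fun i => val (rev_ord (p i)))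
      [:: f (@o 0 isT); f (@o 1 isT); f (@o 2 isT); f (@o 3 isT); f (@o 4 isT)]).
    apply: map_subseq; apply: subseq_enum_ord.
    by rewrite /= !lt.
  have gm (a b : 'I_5) : pattern12453 a < pattern12453 b -> g b < g a.
    rewrite -ltp /g; move: (p (f a)) (p (f b)) => x y /=.
    by have := ltn_ord x; have := ltn_ord y; lia.
  by rewrite !gm // !pattern_val.
move=> [a [b [c [d [e [/subseq_mapP[t te sub] lt]]]]]].
case: t te sub => [|i0 [|i1 [|i2 [|i3 [|i4 []]]]]] //= [ea eb ec ed ee] sub.
have /= /and5P[l1 l2 l3 l4 _] := enum_ord_sorted sub.
pose t := [:: i0; i1; i2; i3; i4].
pose f := [ffun k : 'I_5 => nth i0 t k].
apply/existsP; exists f; apply/andP; split; apply/forallP => x; apply/forallP => y.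
  apply/implyP; rewrite !ffunE.
  by case: x y => [[|[|[|[|[|x]]]]] Hx] // [[|[|[|[|[|y]]]]] Hy] //= _; lia.
have := ltn_ord (p i0); have := ltn_ord (p i1); have := ltn_ord (p i2).
have := ltn_ord (p i3); have := ltn_ord (p i4).
rewrite !pattern_val !ffunE; move: lt; rewrite ea eb ec ed ee.
by case: x y => [[|[|[|[|[|x]]]]] Hx] // [[|[|[|[|[|y]]]]] Hy] //=; lia.
Qed.

Lemma nb_avoidersE n : nb_avoiders n pattern12453 = av54213 n.
Proof.
rewrite /nb_avoiders /av54213 size_filter -(seq.permP (perm_complement_words n)).
rewrite count_map cardE /enum_mem size_filter -enumT.
rewrite (@eq_filter _ _ predT) // filter_predT; apply: eq_count => p /=.
rewrite inE /avoids; congr (~~ _); apply/idP/asboolP => /containsP //.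
Qed.

(** * The growth rate *)

Local Open Scope classical_set_scope.
Local Open Scope ring_scope.

Lemma superadditive_muln (R : realType) (u : nat -> R) m q :
  (forall n, 0 <= u n) -> (forall m n, u m + u n <= u (m + n)%N) ->
  q%:R * u m <= u (q * m)%N.
Proof.
move=> u0 us; elim: q => [|q IH]; first by rewrite mul0r.
rewrite mulSn (le_trans _ (us _ _)) // -natr1 mulrDl mul1r addrC.
by rewrite lerD2l.
Qed.

(** The limit is the supremum of the quotients, hence bounds them all. If [u m / m] is close to it,
    division of [n] by [m] shows that [u n / n] falls short of [u m / m] by at most [u m / n]. *)
Lemma fekete (R : realType) (u : nat -> R) (K : R) :
  (forall n, 0 <= u n) -> (forall m n, u m + u n <= u (m + n)%N) ->
  (forall n, u n <= K * n%:R) ->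
  exists l : R, [/\ u n / n%:R @[n --> \oo] --> l,
    forall n, u n <= l * n%:R & l <= K].
Proof.
move=> u0 us uK.
pose A : set R := [set x | exists2 n, (0 < n)%N & x = u n / n%:R].
have ubA : has_ubound A.
  by exists K => _ [n n0 ->]; rewrite ler_pdivrMr ?ltr0n.
have supA : has_sup A by split=> //; exists (u 1 / 1), 1%N.
have le_sup n : (0 < n)%N -> u n / n%:R <= sup A.
  by move=> n0; apply: ub_le_sup => //; exists n.
exists (sup A); split; last first.
- by apply: ge_sup; [case: supA|move=> _ [n n0 ->]; rewrite ler_pdivrMr ?ltr0n].
- move=> [|n]; last by rewrite -ler_pdivrMr ?ltr0n ?le_sup.
  by rewrite (le_trans (uK 0%N)) // !mulr0.
apply/cvgrPdist_lt => e e0.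
have e2 : 0 < e / 2 by rewrite divr_gt0.
have [_ [m m0 ->] hm] := sup_adherent e2 supA.
near=> n.
have n0 : (0 < n)%N by near: n; apply: nbhs_infty_gt.
have nu : 2 * u m / e < n%:R by near: n; apply: nbhs_infty_gtr.
have nR : 0 < n%:R :> R by rewrite ltr0n.
have mR : 0 < m%:R :> R by rewrite ltr0n.
rewrite ger0_norm ?subr_ge0 ?le_sup // ltrBlDr.
have h1 : (n %/ m)%:R * u m <= u n.
  rewrite (le_trans (superadditive_muln _ _ u0 us)) //.
  rewrite [in leRHS](divn_eq n m) (le_trans _ (us _ _)) // lerDl //.
have h2 : n%:R / m%:R * u m - u m <= (n %/ m)%:R * u m.
  rewrite -[X in _ - X]mul1r -mulrBl ler_wpM2r // lerBlDr natr1 ler_pdivrMr //.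
  by rewrite -natrM ler_nat; apply: ltnW; rewrite ltn_ceil.
have h3 : u m / m%:R - u m / n%:R <= u n / n%:R.
  rewrite ler_pdivlMr // mulrBl divfK ?gt_eqF // (le_trans _ h1) //.
  rewrite (le_trans _ h2) // lerD2r.
  by rewrite [leLHS]mulrC [leLHS]mulrCA [leLHS]mulrC.
have h4 : u m / n%:R < e / 2.
  rewrite ltr_pdivrMr //; move: nu; rewrite ltr_pdivrMr // => nu; lra.
lra.
Unshelve. all: by end_near.
Qed.

Lemma bernoulli (R : realFieldType) (d : R) k : 0 <= d ->
  1 + k%:R * d <= (1 + d) ^+ k.
Proof.
move=> d0; elim: k => [|k IH]; first by rewrite mul0r addr0.
have k0 : 0 <= k%:R :> R by [].
rewrite exprS -natr1; apply: (@le_trans _ _ ((1 + d) * (1 + k%:R * d))).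
  by move: (k%:R) k0 => x x0; nra.
by rewrite ler_wpM2l //; lra.
Qed.

(** If [x / y = 1 + d] with [d > 0], then for [n = 3 k] Bernoulli's inequality gives
    [(k d)^3 <= K (4 k)^2], which bounds [k]. *)
Lemma le_of_expr_le_poly (R : realType) (x y K : R) : 0 < y ->
  (forall n, x ^+ n <= K * n.+1%:R ^+ 2 * y ^+ n) -> x <= y.
Proof.
move=> y0 h; rewrite leNgt; apply/negP => yx.
pose d := x / y - 1.
have d0 : 0 < d by rewrite subr_gt0 ltr_pdivlMr // mul1r.
have xE : x = y * (1 + d) by rewrite /d addrC subrK mulrC divfK ?gt_eqF.
have {}h n : (1 + d) ^+ n <= K * n.+1%:R ^+ 2.
  have := h n; rewrite xE exprMn mulrC ler_pM2r // exprn_gt0 //.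
have K1 : 1 <= K by have := h 0%N; rewrite expr0 expr1n mulr1.
have {h} main k : (0 < k)%N -> k%:R * d ^+ 3 <= 16 * K.
  move=> k0; have kR : 1 <= k%:R :> R by rewrite ler1n.
  have := h (k * 3)%N; rewrite exprM => h1.
  have b : k%:R * d <= (1 + d) ^+ k.
    by apply: le_trans (bernoulli _ (ltW d0)); lra.
  have kd : 0 <= k%:R * d by rewrite mulr_ge0 // ltW.
  have h2 : (k%:R * d) ^+ 3 <= K * (4 * k%:R) ^+ 2.
    apply: le_trans (le_trans h1 _).
      by apply: lerXn2r; rewrite ?nnegrE // (le_trans kd).
    rewrite ler_wpM2l ?(le_trans ler01) //; apply: lerXn2r; rewrite ?nnegrE ?mulr_ge0 ?ler0n //.
    by rewrite -natrM ler_nat; lia.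
  rewrite -(ler_pM2l (x := k%:R ^+ 2)); last by rewrite exprn_gt0 // (lt_le_trans ltr01).
  by move: h2; rewrite !exprMn; lra.
have d3 : 0 < d ^+ 3 by rewrite exprn_gt0.
have b0 : 0 <= 16 * K / d ^+ 3 by rewrite divr_ge0 ?ltW //; lra.
have := main (Num.bound (16 * K / d ^+ 3)).+1 isT.
rewrite leNgt => /negP; apply; rewrite -ltr_pdivrMr //.
by rewrite (lt_le_trans (archi_boundP b0)) // ler_nat.
Qed.

Section Growth.
Variable R : realType.
Local Notation av n := ((av54213 n)%:R : R).

Lemma av54213_limit : exists L : R,
  [/\ growth_rate R pattern12453 = L, 0 < L, forall n, av n <= L ^+ n
    & L <= (1 + 99 / 35) ^+ 2].
Proof.
have av_gt0 n : 0 < av n by rewrite ltr0n av54213_gt0.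
(* Slightly above [sqrt 8]: its square is [9801 / 1225], and [(1 + w) ^+ 2] is still below 14.66. *)
pose w : R := 99 / 35.
have w0 : 0 <= w by rewrite /w; lra.
have w8 : 8 <= w ^+ 2 by rewrite /w; lra.
pose u n : R := ln (av n).
have u0 n : 0 <= u n by rewrite ln_ge0 // ler1n av54213_gt0.
have us m n : u m + u n <= u (m + n)%N.
  rewrite /u -lnM ?posrE // ler_ln ?posrE ?mulr_gt0 //.
  by rewrite -natrM ler_nat av54213_superadditive.
have w1 : 0 < (1 + w) ^+ 2 by rewrite exprn_gt0 // /w; lra.
have uK n : u n <= ln ((1 + w) ^+ 2) * n%:R.
  rewrite mulr_natr -lnXn // ler_ln ?posrE //; last exact: exprn_gt0.
  by rewrite expr2 exprMn av54213_le.
have [l [ul lu lK]] := fekete u0 us uK.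
exists (expR l); split; last first.
- by rewrite -/w -[leRHS](lnK (x := (1 + w) ^+ 2)) ?posrE // ler_expR.
- move=> n; rewrite -expRM_natr -[leLHS](lnK (x := av n)) ?posrE //.
  by rewrite ler_expR; apply: lu.
- exact: expR_gt0.
apply/cvg_lim => //.
rewrite (_ : (fun n => _) = (fun n => expR (u n / n%:R))); last first.
  apply/funext => n; rewrite nb_avoidersE /powR gt_eqF //.
  by rewrite mulrC.
by apply: continuous_cvg ul; apply: continuous_expR.
Qed.

(** The [r]-th power of the left-hand side is at most [L ^+ (r * M.+1 + j)]; letting [r] grow
    removes the constant [L ^+ j]. *)
Lemma growth_glue (L : R) M j : 0 < L -> (forall n, av n <= L ^+ n) ->
  ((size (bits_with M j))%:R ^+ 2 * (av4213 (M - j))%:R : R) <= L ^+ M.+1.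
Proof.
move=> L0 avL; apply: (@le_of_expr_le_poly _ _ _ (L ^+ j)).
  by rewrite exprn_gt0.
move=> r; rewrite expr2 -!natrM -natrX.
apply: (@le_trans _ _ (av (r * M.+1 + j))); first by rewrite ler_nat av54213_glue.
rewrite (le_trans (avL _)) // exprD mulnC exprM mulrC ler_wpM2r //.
  by rewrite !exprn_ge0 // ltW.
by rewrite ler_peMr ?exprn_ge0 ?(ltW L0) // exprn_ege1 // ler1n.
Qed.

Lemma sum_bits_with (w : R) M :
  \sum_(j < M.+1) (size (bits_with M j))%:R * w ^+ (M - j) = (1 + w) ^+ M.
Proof.
rewrite -sum_bits.
under eq_bigr => j _.
  rewrite size_filter -sum1_count natr_sum mulr_suml big_mkcond /=.
  over.
rewrite exchange_big big_seq [RHS]big_seq; apply: eq_bigr => b.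
rewrite mem_bits => /eqP sb.
have cb : (count id b < M.+1)%N by rewrite ltnS -sb count_size.
rewrite (bigD1 (Ordinal cb)) //= eqxx mul1r big1 ?addr0 // => j jb.
by rewrite ifN //; apply: contraNneq jb => e; apply/eqP/val_inj; rewrite /= e.
Qed.

(** By [growth_glue] each of the [M.+1] terms in the expansion of [(1 + w) ^+ M] is at most [S].
    Squaring bounds [(1 + w) ^+ (2 * M)] by [L ^+ M] up to a factor quadratic in [M]. *)
Lemma growth_lower (L w : R) : 0 < L -> 0 <= w -> w ^+ 2 <= 153 / 20 ->
  (forall n, av n <= L ^+ n) -> (1 + w) ^+ 2 <= L.
Proof.
move=> L0 w0 w2 avL; have [c c0 le_av] := av4213_ge R.
apply: (@le_of_expr_le_poly _ _ _ (L / c)) => // M.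
pose S := Num.sqrt (L ^+ M.+1 / c).
have S2 : S ^+ 2 = L ^+ M.+1 / c.
  by rewrite sqr_sqrtr // divr_ge0 ?exprn_ge0 ?ltW.
have le_S (j : 'I_M.+1) : (size (bits_with M j))%:R * w ^+ (M - j) <= S.
  have T0 : 0 <= (size (bits_with M j))%:R * w ^+ (M - j).
    by rewrite mulr_ge0 ?exprn_ge0.
  rewrite -[leLHS](ger0_norm T0) -sqrtr_sqr ler_wsqrtr //.
  rewrite ler_pdivlMr // (le_trans _ (growth_glue M j L0 avL)) //.
  rewrite exprMn -mulrA ler_wpM2l ?exprn_ge0 // mulrC.
  rewrite (le_trans _ (le_av _)) // ler_wpM2l ?(ltW c0) //.
  rewrite -exprM mulnC exprM; apply: lerXn2r; rewrite // nnegrE ?exprn_ge0 //; lra.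
have : (1 + w) ^+ M <= M.+1%:R * S.
  rewrite -sum_bits_with (le_trans (ler_sum _ (fun j _ => le_S j))) //.
  by rewrite sumr_const card_ord mulr_natl.
have w1 : 0 <= (1 + w) ^+ M by rewrite exprn_ge0 //; lra.
move=> h; rewrite -exprM mulnC exprM.
apply: (@le_trans _ _ ((M.+1%:R * S) ^+ 2)).
  by apply: lerXn2r; rewrite // nnegrE // (le_trans w1).
rewrite exprMn S2 (exprS L) le_eqVlt; apply/orP; left.
by move: (L ^+ M) (c^-1) (M.+1%:R) => x y z; apply/eqP; ring.
Qed.
End Growth.

Theorem theorem3p6 (R : realType) :
  (1412%:R / 100%:R <= growth_rate R pattern12453 <= 1466%:R / 100%:R) /\
  growth_rate R pattern12453 \isn't a Num.int.
Proof.
have [L [-> L0 avL le_L]] := av54213_limit R.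
(* Slightly below [sqrt 7.65]: the square of [69 / 25] is 7.6176, and [(94 / 25) ^+ 2] is
   14.1376. *)
have ge_L : (1 + 69 / 25) ^+ 2 <= L by apply: growth_lower L0 _ _ avL; lra.
have lo : 1412%:R / 100%:R <= L.
  rewrite (le_trans _ ge_L) //; lra.
have up : L <= 1466%:R / 100%:R.
  rewrite (le_trans le_L) //; lra.
split; first by rewrite lo.
apply/negP => /intrP[m Lm].
have [m1 m2] : 14%:~R < L /\ L < 15%:~R by split; lra.
by move: m1 m2; rewrite Lm !ltr_int; lia.
Qed.
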